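(* In the setting described in the context, let $$u_{\mathrm{as},S}(x)=u_0(x)+v(\xi,s)+v^-(\xi^-,s^-)+q(\eta),$$ where $\eta=x/\varepsilon$, $\xi=r/\varepsilon$, $\xi^-=r^-/\varepsilon$. Then $$F u_{\mathrm{as},S}=O(\varepsilon^2)\ \text{ in }S,\qquad u_{\mathrm{as},S}(x)=g(x)+O(\varepsilon^2)\ \text{ for }x\in\partial S,$$ where $Fu=-\varepsilon^2\Delta u+b(x,u)$ and $O(\varepsilon^2)$ denotes a quantity bounded in absolute value by $C\varepsilon^2$ for all sufficiently small $\varepsilon>0$, with $C$ independent of $\varepsilon$ and $x$.
   Context: Setting. $S\subset\mathbb R^2$ is an open convex sector with vertex $O$ (the origin), opening angle in $(0,\pi)$, and sides (rays) $\Gamma$ and $\Gamma^-$. Let $b(x,u)$ be smooth, let $g$ on $\partial S$ be smooth on each of $\Gamma,\Gamma^-$ and continuous at $O$ (write $g^-$ for $g|_{\Gamma^-}$), and let $u_0$ be a smooth function with $b(x,u_0(x))=0$ for $x\in\bar S$. The functions $u_0$, $g$, $b(\cdot,t)$ and their derivatives are bounded as $|x|\to\infty$ (for $b$ uniformly for $t$ in compact sets). Assume: (A1) there is $\gamma>0$ with $b_u(x,u_0(x))>\gamma^2$ for all $x\in S$; (A2) $\int_{u_0(x)}^{w}b(x,t)\,dt>0$ for all $w\in(u_0(x),g(x)]$, $x\in\partial S$; (A3) $b(O,g(O))>0$; (A4) $u_0(x)<g(x)$ for all $x\in\partial S$. Define $B(x,t)=b(x,u_0(x)+t)$; $B_t$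 and $\nabla_xB$ denote derivatives with respect to the second and first argument. Coordinates. Let $\mathbf e_s$ be the unit vector in the direction of $\Gamma$ and $\mathbf e_r$ the unit vector orthogonal to it pointing into $S$; similarly $\mathbf e_{s^-},\mathbf e_{r^-}$ for $\Gamma^-$. Write $x=s\mathbf e_s+r\mathbf e_r=s^-\mathbf e_{s^-}+r^-\mathbf e_{r^-}$, $\bar x=s\mathbf e_s$, and $\eta=x/\varepsilon$, $\xi=r/\varepsilon$, $\sigma=s/\varepsilon$, $\xi^-=r^-/\varepsilon$, $\sigma^-=s^-/\varepsilon$. Boundary layer functions. The functions $u_0$, $b$ are extended smoothly to $\mathbb R^2$ and $\mathbb R^2\times\mathbb R$ so that $b(x,u_0(x))=0$, A1 and the boundedness assumptions hold on $\mathbb R^2$, and $g|_\Gamma$ is extended smoothly to the line through $\Gamma$ so that A2, A4 hold on it. For $s\in\mathbb R$, $v_0(\xi,s)$ and $v_1(\xi,s)$ solve, for $\xi>0$, $$-\partial_\xi^2v_0+B(\bar x,v_0)=0,\quad v_0(0,s)=g(\bar x)-u_0(\bar x),\quad v_0(\infty,s)=0,$$ $$-\partial_\xi^2v_1+v_1B_t(\bar x,v_0)=-\xi\,\mathbf e_r\cdot\nabla_xB(\bar x,v_0),\quad v_1(0,s)=v_1(\infty,s)=0.$$ Set $v=v_0+\varepsilon v_1$. The functions $v_0^-,v_1^-,v^-=v_0^-+\varepsilon v_1^-$ of $(\xi^-,s^-)$ are defined analogously for $\Gamma^-$. It is known (and may be used) that these functions exist, $v_0,v_0^-\ge0$, and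 for every $k\ge0$ and fixed small $\delta>0$ there is $C$ with $|\partial_\xi^kv_0|+|\partial_s^kv_0|+|\partial_\xi^kv_1|+|\partial_s^kv_1|\le Ce^{-(\gamma-\delta)\xi}$ for $\xi\ge0$, $s\in\mathbb R$, and similarly for $v_0^-,v_1^-$. A small circle means evaluation at $s=0$ (resp. $s^-=0$): $\mathring v_0(\xi)=v_0(\xi,0)$, $\mathring v_1(\xi)=v_1(\xi,0)$, $\mathring v_{0,s}(\xi)=\partial_sv_0(\xi,s)|_{s=0}$, and similarly $\mathring v_0^-,\mathring v_1^-,\mathring v^-_{0,s^-}$. Corner layer functions. $z_0(\eta)$ is a bounded solution of $$-\Delta_\eta z_0+B(O,z_0)=0\text{ in }S,\qquad z_0=g(O)-u_0(O)\text{ on }\partial S,$$ $z_1(\eta)$ is a solution of $$-\Delta_\eta z_1+z_1B_t(O,z_0)=-\eta\cdot\nabla_xB(O,z_0)\text{ in }S,$$ $$z_1=\sigma\,\partial_s(g-u_0)|_{x=O}\text{ on }\Gamma,\qquad z_1=\sigma^-\,\partial_{s^-}(g^--u_0)|_{x=O}\text{ on }\Gamma^-,$$ and $$q_0=z_0-\mathring v_0(\xi)-\mathring v_0^-(\xi^-),\quad q_1=z_1-[\mathring v_1(\xi)+\sigma\mathring v_{0,s}(\xi)]-[\mathring v_1^-(\xi^-)+\sigma^-\mathring v^-_{0,s^-}(\xi^-)],\quad q=q_0+\varepsilon q_1.$$ It is known (and may be used) that $z_0,z_1$ exist and can be chosen so that, as is assumed, $|q_0|+|q_1|\le C_1e^{-c_1|\eta|}$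 in $S$ for some constants $C_1,c_1>0$, and $z_0\ge\max\{\mathring v_0,\mathring v_0^-\}$. *)

(* Defs.v *)
From Stdlib Require Import Reals List.
From Coquelicot Require Import Coquelicot.
Open Scope R_scope.

(* Iterated directional derivatives, continuity and smoothness, for a function on
   a normed module (here R^2 and R^2 x R). *)

Definition ddir {V : NormedModule R_AbsRing} (e : V) (f : V -> R) (x : V) : R :=
  Derive (fun t => f (plus x (scal t e))) 0.

Definition ex_ddir {V : NormedModule R_AbsRing} (e : V) (f : V -> R) (x : V) : Prop :=
  ex_derive (fun t => f (plus x (scal t e))) 0.

Fixpoint ddirs {V : NormedModule R_AbsRing} (l : list V) (f : V -> R) : V -> R :=
  match l with
  | nil => f
  | e :: l' => ddir e (ddirs l' f)
  end.

(* Meant for open D: all iterated directional derivatives of order < n are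
   differentiable in every direction, and those of order <= n are continuous. *)
Definition Ck_on {V : NormedModule R_AbsRing} (n : nat) (D : V -> Prop) (f : V -> R) : Prop :=
  forall (l : list V) (x : V), D x ->
    ((length l <= n)%nat -> continuous (ddirs l f) x) /\
    ((length l < n)%nat -> forall e : V, ex_ddir e (ddirs l f) x).

Definition smooth_on {V : NormedModule R_AbsRing} (D : V -> Prop) (f : V -> R) : Prop :=
  forall n : nat, Ck_on n D f.

Definition continuous_on_set {V : NormedModule R_AbsRing} (D : V -> Prop) (f : V -> R) : Prop :=
  forall x : V, D x -> filterlim f (within D (locally x)) (locally (f x)).

Definition everywhere {T : Type} (_ : T) : Prop := True.

(* The norm of Coquelicot on R * R is the Euclidean one. *)
Definition dot (x y : R * R) : R := fst x * fst y + snd x * snd y.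

Definition origin : R * R := (0, 0).

Definition grad (f : R * R -> R) (x : R * R) : R * R :=
  (Derive (fun t => f (t, snd x)) (fst x), Derive (fun t => f (fst x, t)) (snd x)).

Definition laplacian (f : R * R -> R) (x : R * R) : R :=
  Derive_n (fun t => f (t, snd x)) 2 (fst x) + Derive_n (fun t => f (fst x, t)) 2 (snd x).

(* Sector with sides along es and em; the suffix m stands for the superscript
   minus, attached to the side Gamma^-. *)

Definition sector (es em x : R * R) : Prop :=
  exists a c : R, 0 < a /\ 0 < c /\ x = plus (scal a es) (scal c em).

Definition ray (e x : R * R) : Prop := exists a : R, 0 <= a /\ x = scal a e.

Definition sector_boundary (es em x : R * R) : Prop := ray es x \/ ray em x.

Definition sector_closure (es em x : R * R) : Prop :=
  sector es em x \/ sector_boundary es em x.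

Record sector_frame (omega : R) (es er em erm : R * R) : Prop := {
  frame_angle : 0 < omega < PI;
  frame_es : norm es = 1;
  frame_em : norm em = 1;
  frame_opening : dot es em = cos omega;
  frame_er : norm er = 1;
  frame_er_orth : dot er es = 0;
  frame_er_inward : forall x, sector es em x -> 0 < dot x er;
  frame_erm : norm erm = 1;
  frame_erm_orth : dot erm em = 0;
  frame_erm_inward : forall x, sector es em x -> 0 < dot x erm
}.

(* b and u0 denote the functions already extended to R^2 x R and R^2.  They are
   smooth up to the boundary of the sector in the sense that these smooth
   extensions exist.  All derivatives of b, also those in the second argument,
   are bounded for large |x|. *)
Record reaction_data (gamma : R) (b : R * R -> R -> R) (u0 : R * R -> R) : Prop := {
  b_smooth : smooth_on everywhere (fun p : (R * R) * R => b (fst p) (snd p));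
  u0_smooth : smooth_on everywhere u0;
  b_u0 : forall x, b x (u0 x) = 0;
  u0_bounded : forall l : list (R * R), exists M K : R,
    forall x, M <= norm x -> Rabs (ddirs l u0 x) <= K;
  b_bounded : forall (l : list ((R * R) * R)) (T : R), exists M K : R,
    forall (x : R * R) (t : R), M <= norm x -> Rabs t <= T ->
      Rabs (ddirs l (fun p : (R * R) * R => b (fst p) (snd p)) (x, t)) <= K;
  gamma_pos : 0 < gamma;
  assumption_A1 : forall x, gamma ^ 2 < Derive (b x) (u0 x)
}.

(* gl is the boundary datum g on the side of direction e as a function of the
   abscissa s, extended to the whole line s in R. *)
Record side_data (b : R * R -> R -> R) (u0 g : R * R -> R) (e : R * R) (gl : R -> R) : Prop := {
  gl_restr : forall s, 0 <= s -> g (scal s e) = gl s;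
  gl_smooth : forall (k : nat) (s : R), ex_derive_n gl k s;
  gl_bounded : forall k : nat, exists M K : R,
    forall s, M <= s -> Rabs (Derive_n gl k s) <= K;
  assumption_A2 : forall s w, u0 (scal s e) < w <= gl s ->
    0 < RInt (b (scal s e)) (u0 (scal s e)) w;
  assumption_A4 : forall s, u0 (scal s e) < gl s
}.

Definition B (b : R * R -> R -> R) (u0 : R * R -> R) (x : R * R) (t : R) : R :=
  b x (u0 x + t).

Definition B_t (b : R * R -> R -> R) (u0 : R * R -> R) (x : R * R) (t : R) : R :=
  Derive (B b u0 x) t.

Definition grad_B (b : R * R -> R -> R) (u0 : R * R -> R) (x : R * R) (t : R) : R * R :=
  grad (fun y => B b u0 y t) x.

(* v0 and v1 are functions of (xi, s), smooth for xi > 0 and continuous up to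
   xi = 0; their values for xi < 0 are irrelevant.  This is why the bounds on
   the derivatives are stated for xi > 0 (those at xi = 0 would concern one-sided
   derivatives). *)
Record boundary_layer (gamma : R) (b : R * R -> R -> R) (u0 : R * R -> R)
    (es er : R * R) (gl : R -> R) (v0 v1 : R * R -> R) : Prop := {
  v0_smooth : smooth_on (fun p => 0 < fst p) v0;
  v1_smooth : smooth_on (fun p => 0 < fst p) v1;
  v0_cont : continuous_on_set (fun p => 0 <= fst p) v0;
  v1_cont : continuous_on_set (fun p => 0 <= fst p) v1;
  v0_eq : forall xi s, 0 < xi ->
    - Derive_n (fun t => v0 (t, s)) 2 xi + B b u0 (scal s es) (v0 (xi, s)) = 0;
  v0_bc : forall s, v0 (0, s) = gl s - u0 (scal s es);
  v0_infty : forall s, is_lim (fun xi => v0 (xi, s)) p_infty 0;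
  v1_eq : forall xi s, 0 < xi ->
    - Derive_n (fun t => v1 (t, s)) 2 xi + v1 (xi, s) * B_t b u0 (scal s es) (v0 (xi, s))
    = - xi * dot er (grad_B b u0 (scal s es) (v0 (xi, s)));
  v1_bc : forall s, v1 (0, s) = 0;
  v1_infty : forall s, is_lim (fun xi => v1 (xi, s)) p_infty 0;
  v0_nonneg : forall xi s, 0 <= xi -> 0 <= v0 (xi, s);
  v_decay : forall (k : nat) (delta : R), 0 < delta < gamma -> exists K : R,
    forall xi s, 0 < xi ->
      Rabs (Derive_n (fun t => v0 (t, s)) k xi) + Rabs (Derive_n (fun t => v0 (xi, t)) k s)
      + Rabs (Derive_n (fun t => v1 (t, s)) k xi) + Rabs (Derive_n (fun t => v1 (xi, t)) k s)
      <= K * exp (- (gamma - delta) * xi)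
}.

Definition q0 (er erm : R * R) (v0 v0m z0 : R * R -> R) (eta : R * R) : R :=
  z0 eta - v0 (dot eta er, 0) - v0m (dot eta erm, 0).

Definition layer1 (es er : R * R) (v0 v1 : R * R -> R) (eta : R * R) : R :=
  v1 (dot eta er, 0) + dot eta es * Derive (fun s => v0 (dot eta er, s)) 0.

Definition q1 (es er em erm : R * R) (v0 v1 v0m v1m z1 : R * R -> R) (eta : R * R) : R :=
  z1 eta - layer1 es er v0 v1 eta - layer1 em erm v0m v1m eta.

Record corner_layer (b : R * R -> R -> R) (u0 g : R * R -> R) (es er em erm : R * R)
    (gl glm : R -> R) (v0 v1 v0m v1m z0 z1 : R * R -> R) : Prop := {
  z0_C2 : Ck_on 2 (sector es em) z0;
  z0_cont : continuous_on_set (sector_closure es em) z0;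
  z0_bounded : exists K : R, forall eta, sector es em eta -> Rabs (z0 eta) <= K;
  z0_eq : forall eta, sector es em eta ->
    - laplacian z0 eta + B b u0 origin (z0 eta) = 0;
  z0_bc : forall eta, sector_boundary es em eta -> z0 eta = g origin - u0 origin;
  z1_C2 : Ck_on 2 (sector es em) z1;
  z1_cont : continuous_on_set (sector_closure es em) z1;
  z1_eq : forall eta, sector es em eta ->
    - laplacian z1 eta + z1 eta * B_t b u0 origin (z0 eta)
    = - dot eta (grad_B b u0 origin (z0 eta));
  z1_bc : forall sigma, 0 <= sigma ->
    z1 (scal sigma es) = sigma * Derive (fun s => gl s - u0 (scal s es)) 0;
  z1_bcm : forall sigma, 0 <= sigma ->
    z1 (scal sigma em) = sigma * Derive (fun s => glm s - u0 (scal s em)) 0;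
  q_decay : exists C1 c1 : R, 0 < C1 /\ 0 < c1 /\ forall eta, sector es em eta ->
    Rabs (q0 er erm v0 v0m z0 eta) + Rabs (q1 es er em erm v0 v1 v0m v1m z1 eta)
    <= C1 * exp (- c1 * norm eta);
  z0_ge : forall eta, sector es em eta ->
    Rmax (v0 (dot eta er, 0)) (v0m (dot eta erm, 0)) <= z0 eta
}.

Definition v_as (eps : R) (v0 v1 : R * R -> R) (xi s : R) : R :=
  v0 (xi, s) + eps * v1 (xi, s).

Definition u_as (es er em erm : R * R) (u0 v0 v1 v0m v1m z0 z1 : R * R -> R)
    (eps : R) (x : R * R) : R :=
  let eta : R * R := scal (/ eps) x in
  u0 x + v_as eps v0 v1 (dot x er / eps) (dot x es)
  + v_as eps v0m v1m (dot x erm / eps) (dot x em)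
  + (q0 er erm v0 v0m z0 eta + eps * q1 es er em erm v0 v1 v0m v1m z1 eta).

Definition F (b : R * R -> R -> R) (eps : R) (u : R * R -> R) (x : R * R) : R :=
  - eps ^ 2 * laplacian u x + b x (u x).

(* Main.v *)
Require Import Defs.
From Stdlib Require Import Reals List Lra Lia FunctionalExtensionality IndefiniteDescription Classical.
From Coquelicot Require Import Coquelicot.
Import ListNotations.
Open Scope R_scope.
Set Bullet Behavior "Strict Subproofs".

(** The approximation is built so that every error is the second-order Taylor
remainder, in eps, of a function whose second derivative is bounded uniformly
in the position.  Write B(x,t) = b(x, u0(x) + t), so that B(x,0) = 0.

Fix a point eta of the stretched sector, with xi, sigma its normal and
tangential coordinates with respect to one side, and let
a(h) = v0(xi, h sigma) + h v1(xi, h sigma), let a^-(h) be its analogue for the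
other side and c(h) = q0(eta) + h q1(eta).  At x = eps eta the approximation is
u0(x) + a(eps) + a^-(eps) + c(eps), hence b(x, u_as) = B(eps eta, a + a^- + c).

The equations for v0 and v1 say that the normal derivatives v0'' and v1'' are
the value and the derivative at h = 0 of B(sbar + h xi e_r, v0 + h v1), where
sbar is the foot of x on the side.  So eps^2 times the Laplacian of a boundary
layer is B(x, a(eps)) up to a Taylor remainder (layer_normal_residual) and up
to the term eps^2 d_ss v.

The equations for z0 and z1, together with the equation obtained by
differentiating that of v0 along the side, say in the same way that
eps^2 times the Laplacian of the corner layer is phi(0) + eps phi'(0) with
phi(h) = B(h eta, a + a^- + c) - B(h eta, a) - B(h eta, a^-), and phi(eps) is
exactly what is missing to B(x, a + a^- + c) (corner_residual).  The point is
the bound on phi''.  Each of its terms grows polynomially in eta, but the three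
values of B almost cancel: what survives carries either a factor a a^-, or a
factor c (corner_interaction_bound).  Both decay exponentially in |eta|, the
former because the sum of the distances to the two sides controls |eta|
(sector_distance).

On a side, v0 takes up g - u0, and the boundary values of z0 and z1 leave
minus the first-order expansion of the layer of the opposite side, so the error
is the Taylor remainder of a^- alone (layer_path_taylor_along_ray). *)

(** * Directional derivatives along curves *)

Lemma is_derive_eq (f : R -> R) (t l l' : R) : is_derive f t l -> l = l' -> is_derive f t l'.
Proof. now intros H <-. Qed.

Lemma is_derive_shift (f : R -> R) (t l : R) :
  is_derive (fun h => f (t + h)) 0 l -> is_derive f t l.
Proof.
  intros H.
  apply (is_derive_ext (fun y => (fun h => f (t + h)) (y - t))).
  { intros y; simpl; f_equal; ring. }
  replace l with (scal 1 l) by apply (scal_one l).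
  apply (is_derive_comp (fun h => f (t + h)) (fun y => y - t)).
  - replace (t - t) with 0 by ring. exact H.
  - auto_derive; auto; ring.
Qed.

Lemma scal_0_l {V : NormedModule R_AbsRing} (e : V) : scal 0 e = zero.
Proof. exact (scal_zero_l e). Qed.

Lemma is_ddir {V : NormedModule R_AbsRing} (e : V) (f : V -> R) (x : V) :
  ex_ddir e f x -> is_derive (fun t => f (plus x (scal t e))) 0 (ddir e f x).
Proof. intros H; apply Derive_correct, H. Qed.

Lemma is_derive_line {V : NormedModule R_AbsRing} (e : V) (f : V -> R) (x : V) (t : R) :
  ex_ddir e f (plus x (scal t e)) ->
  is_derive (fun s => f (plus x (scal s e))) t (ddir e f (plus x (scal t e))).
Proof.
  intros H. apply is_derive_shift.
  apply (is_derive_ext (fun h : R => f (plus (plus x (scal t e)) (scal h e)))).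
  { intros h. f_equal. rewrite <- plus_assoc. f_equal.
    symmetry; exact (scal_distr_r t h e). }
  now apply is_ddir.
Qed.

Lemma continuous_plane {V : NormedModule R_AbsRing} (x e1 e2 : V) (p : R * R) :
  continuous (fun u : R * R => plus x (plus (scal (snd u) e2) (scal (fst u) e1))) p.
Proof.
  apply (continuous_plus (fun _ => x) (fun u : R*R => plus (scal (snd u) e2) (scal (fst u) e1))).
  apply continuous_const.
  apply (continuous_plus (fun u : R*R => scal (snd u) e2) (fun u : R*R => scal (fst u) e1)).
  - apply (continuous_scal (fun u : R*R => snd u) (fun _ => e2)).
    destruct p; apply continuous_snd. apply continuous_const.
  - apply (continuous_scal (fun u : R*R => fst u) (fun _ => e1)).
    destruct p; apply continuous_fst. apply continuous_const.
Qed.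

(** The curve leaves x along e2 and drifts along e1 by a(t).  A linear a gives
additivity of ddir in the direction; other choices of a give derivatives along
curves and of the composition with the displacement t -> u0(x) + t. *)
Lemma is_derive_two_directions {V : NormedModule R_AbsRing} (f : V -> R) (x e1 e2 : V)
    (a : R -> R) (a' : R) :
  locally x (fun y => ex_ddir e1 f y) -> continuous (ddir e1 f) x -> ex_ddir e2 f x ->
  a 0 = 0 -> is_derive a 0 a' ->
  is_derive (fun t => f (plus x (plus (scal t e2) (scal (a t) e1)))) 0
    (ddir e2 f x + a' * ddir e1 f x).
Proof.
  intros H1 C1 H2 a0 Ha.
  set (P := fun s t : R => plus x (plus (scal t e2) (scal s e1)) : V).
  assert (P0 : P 0 0 = x).
  { unfold P. rewrite !scal_0_l. now rewrite !plus_zero_r. }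
  assert (CP : continuous (fun u : R * R => P (fst u) (snd u)) (0, 0))
    by apply continuous_plane.
  assert (FD := is_derive_filterdiff (fun s t => f (P s t)) 0 0
                  (fun s t => ddir e1 f (P s t)) (ddir e2 f x)).
  assert (FD' : filterdiff (fun u : R * R => f (P (fst u) (snd u))) (locally (0, 0))
     (fun u : R * R => plus (scal (fst u) (ddir e1 f (P 0 0))) (scal (snd u) (ddir e2 f x)))).
  { apply FD.
    - assert (L : locally (P 0 0) (fun y => ex_ddir e1 f y)) by now rewrite P0.
      generalize (CP _ L). unfold filtermap. apply filter_imp.
      intros [s t]; simpl; intros H.
      apply (is_derive_ext (fun z => f (plus (plus x (scal t e2)) (scal z e1)))).
      { intros z; unfold P; now rewrite plus_assoc. }
      unfold P; rewrite plus_assoc. apply is_derive_line.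
      now rewrite <- plus_assoc.
    - apply (is_derive_ext (fun t => f (plus x (scal t e2)))).
      { intros t; unfold P. now rewrite (scal_0_l e1), plus_zero_r. }
      now apply is_ddir.
    - apply (continuous_comp (fun u : R * R => P (fst u) (snd u)) (ddir e1 f)).
      exact CP. simpl. now rewrite P0. }
  assert (D : filterdiff (fun t => f (P (a t) t)) (locally 0)
     (fun t => plus (scal (scal t a') (ddir e1 f (P 0 0))) (scal t (ddir e2 f x)))).
  { apply (filterdiff_comp'_2 a (fun t => t) (fun s t => f (P s t)) 0
        (fun t => scal t a') (fun t => t)
        (fun s t => plus (scal s (ddir e1 f (P 0 0))) (scal t (ddir e2 f x)))).
    - exact Ha.
    - apply filterdiff_id.
    - rewrite a0. exact FD'. }
  unfold is_derive.
  eapply filterdiff_ext_lin. exact D.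
  intros t; simpl. rewrite P0. unfold scal, plus; simpl. unfold mult; simpl. ring.
Qed.

Lemma is_derive_scale_arg (f : R -> R) (c l : R) :
  is_derive f 0 l -> is_derive (fun t => f (c * t)) 0 (c * l).
Proof.
  intros H.
  apply (is_derive_comp f (fun t => c * t) 0 l c).
  now rewrite Rmult_0_r. auto_derive; auto; ring.
Qed.

Lemma is_derive_scaled_direction {V : NormedModule R_AbsRing} (f : V -> R) (x e : V) (c : R) :
  ex_ddir e f x ->
  is_derive (fun t => f (plus x (scal t (scal c e)))) 0 (c * ddir e f x).
Proof.
  intros H.
  apply (is_derive_ext (fun t => f (plus x (scal (c * t) e)))).
  { intros t; rewrite (scal_assoc t c). unfold mult; simpl. now rewrite Rmult_comm. }
  apply (is_derive_scale_arg (fun t => f (plus x (scal t e)))). now apply is_ddir.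
Qed.

Lemma is_derive_combination {V : NormedModule R_AbsRing} (f : V -> R) (x e1 e2 : V) (c1 c2 : R) :
  locally x (fun y => ex_ddir e1 f y) -> continuous (ddir e1 f) x -> ex_ddir e2 f x ->
  is_derive (fun t => f (plus x (scal t (plus (scal c1 e1) (scal c2 e2))))) 0
    (c1 * ddir e1 f x + c2 * ddir e2 f x).
Proof.
  intros H1 C1 H2.
  assert (E := is_derive_scaled_direction f x e2 c2 H2).
  assert (D := is_derive_two_directions f x e1 (scal c2 e2) (fun t => c1 * t) c1 H1 C1
     (ex_intro _ _ E) (Rmult_0_r _)).
  replace (ddir (scal c2 e2) f x) with (c2 * ddir e2 f x) in D
    by (symmetry; apply is_derive_unique, E).
  rewrite Rplus_comm.
  eapply is_derive_ext; [|apply D].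
  2: auto_derive; auto; ring.
  intros t; simpl. do 2 f_equal. rewrite scal_distr_l, plus_comm. f_equal.
  rewrite (scal_assoc t c1). unfold mult; simpl. now rewrite Rmult_comm.
Qed.

(** * Functions with derivatives bounded on slabs *)

Notation plane := (prod_NormedModule R_AbsRing R_NormedModule R_NormedModule).
Notation space_time := (prod_NormedModule R_AbsRing plane R_NormedModule).

Lemma Rabs_fst_le_norm (x : R * R) : Rabs (fst x) <= norm x.
Proof. destruct x as [x1 x2]. exact (Rle_trans _ _ _ (Rmax_l _ _) (proj1 (norm_prod x1 x2))). Qed.

Lemma Rabs_snd_le_norm (x : R * R) : Rabs (snd x) <= norm x.
Proof. destruct x as [x1 x2]. exact (Rle_trans _ _ _ (Rmax_r _ _) (proj1 (norm_prod x1 x2))). Qed.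

(** The bound for large |x| is completed on a ball, which finitely many boxes cover so
that f varies by less than 1 on each. *)
Lemma continuous_slab_bounded (f : (R * R) * R -> R) (T : R) :
  (forall p, continuous f p) ->
  (exists M K, forall x t, M <= norm x -> Rabs t <= T -> Rabs (f (x, t)) <= K) ->
  exists K, forall x t, Rabs t <= T -> Rabs (f (x, t)) <= K.
Proof.
  intros Cf (M & K & HK).
  set (emb := fun p : Compactness.Tn 3 R => ((fst p, fst (snd p)), fst (snd (snd p)))).
  assert (Hd : forall p, exists d : posreal, forall q, close_n 3 d q p ->
             Rabs (f (emb q) - f (emb p)) < 1).
  { intros p. destruct (proj1 (filterlim_locally f (f (emb p))) (Cf (emb p)) (mkposreal 1 Rlt_0_1))
      as [d Hd].
    exists d. intros [q1 [q2 [q3 []]]]. destruct p as [p1 [p2 [p3 []]]]. simpl.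
    intros (h1 & h2 & h3 & _). apply (Hd ((q1, q2), q3)). repeat split; assumption. }
  set (delta := fun p => proj1_sig (constructive_indefinite_description _ (Hd p))).
  assert (Hdelta : forall p q, close_n 3 (delta p) q p -> Rabs (f (emb q) - f (emb p)) < 1).
  { intros p. exact (proj2_sig (constructive_indefinite_description _ (Hd p))). }
  clearbody delta.
  destruct (NNPP _ (compactness_list 3 (- M, (- M, (- T, tt))) (M, (M, (T, tt))) delta))
    as [l Hl].
  assert (Hm : exists K', forall p, In p l -> Rabs (f (emb p)) <= K').
  { clear Hl. induction l as [|p l [K' IH]].
    - exists 0. intros p [].
    - exists (Rmax (Rabs (f (emb p))) K'). intros q [<-|Hq].
      + apply Rmax_l.
      + apply Rle_trans with K'; [now apply IH|apply Rmax_r]. }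
  destruct Hm as [K' HK'].
  exists (Rmax K (K' + 1)). intros x t Ht.
  destruct (Rle_dec M (norm x)) as [HM|HM].
  - apply Rle_trans with K; [now apply HK|apply Rmax_l].
  - apply Rle_trans with (K' + 1); [|apply Rmax_r].
    assert (h1 := Rabs_fst_le_norm x). assert (h2 := Rabs_snd_le_norm x).
    destruct x as [x1 x2].
    destruct (Hl (x1, (x2, (t, tt)))) as (p & Hp & _ & Hc).
    { apply Rnot_le_lt in HM.
      assert (B1 := proj1 (Rabs_le_between _ _) (Rle_trans _ _ _ h1 (Rlt_le _ _ HM))).
      assert (B2 := proj1 (Rabs_le_between _ _) (Rle_trans _ _ _ h2 (Rlt_le _ _ HM))).
      assert (B3 := proj1 (Rabs_le_between _ _) Ht).
      cbn [fst snd] in B1, B2. now repeat split. }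
    specialize (Hdelta _ _ Hc). specialize (HK' _ Hp).
    change (emb (x1, (x2, (t, tt)))) with ((x1, x2), t) in Hdelta.
    replace (f (x1, x2, t)) with ((f (x1, x2, t) - f (emb p)) + f (emb p)) by ring.
    eapply Rle_trans; [apply Rabs_triang|lra].
Qed.

(** Recursion on the order, rather than a bound on iterated derivatives, makes
stability under products and displacement an induction that needs no formula
for higher derivatives of a composition. *)
Fixpoint tame (k : nat) (f : (R * R) * R -> R) : Prop :=
  (forall p, continuous f p) /\
  (forall T, exists K, forall x t, Rabs t <= T -> Rabs (f (x, t)) <= K) /\
  match k with
  | O => True
  | S k' => forall e, (forall p, ex_ddir e f p) /\ tame k' (ddir e f)
  end.

Lemma tame_continuous k f p : tame k f -> continuous f p.
Proof. destruct k; intros H; apply H. Qed.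

Lemma tame_bounded k f T : tame k f ->
  exists K, forall x t, Rabs t <= T -> Rabs (f (x, t)) <= K.
Proof. destruct k; intros (_ & H & _); apply H. Qed.

Lemma tame_ex_ddir k f e p : tame (S k) f -> ex_ddir e f p.
Proof. intros (_ & _ & H). exact (proj1 (H e) p). Qed.

Lemma tame_ddir k f e : tame (S k) f -> tame k (ddir e f).
Proof. intros (_ & _ & H). exact (proj2 (H e)). Qed.

Lemma tame_weaken k f : tame (S k) f -> tame k f.
Proof.
  revert f; induction k as [|k IH]; intros f (C & Bd & D).
  - repeat split; auto.
  - split; [|split]; auto. intros e. destruct (D e) as [D1 D2]. split; [exact D1|exact (IH _ D2)].
Qed.

Lemma tame_of_bounded_derivatives (f : (R * R) * R -> R) :
  smooth_on everywhere f ->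
  (forall l T, exists M K, forall x t, M <= norm x -> Rabs t <= T ->
     Rabs (ddirs l f (x, t)) <= K) ->
  forall k, tame k f.
Proof.
  intros S Hb.
  enough (H : forall k l, tame k (ddirs l f)) by (intros k; exact (H k nil)).
  induction k as [|k IH]; intros l.
  all: assert (Cl : forall p, continuous (ddirs l f) p)
      by (intros p; apply (proj1 (S (length l) l p I)), le_n).
  all: split; [exact Cl|split].
  1, 3: intros T; apply continuous_slab_bounded; [exact Cl|apply Hb].
  - exact I.
  - intros e. split.
    + intros p; apply (proj2 (S (Datatypes.S (length l)) l p I)), le_n.
    + apply (IH (e :: l)).
Qed.

Lemma tame_plus k f g : tame k f -> tame k g -> tame k (fun p => f p + g p).
Proof.
  revert f g; induction k as [|k IH]; intros f g Hf Hg.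
  all: split; [intros p; apply (continuous_plus f g); eapply tame_continuous; eassumption|].
  all: split; [intros T; destruct (tame_bounded _ _ T Hf) as [K HK];
    destruct (tame_bounded _ _ T Hg) as [K' HK']; exists (K + K'); intros x t Ht;
    eapply Rle_trans; [apply Rabs_triang|apply Rplus_le_compat; auto]|]; auto.
  intros e.
  assert (D : forall p, is_derive (fun t => f (plus p (scal t e)) + g (plus p (scal t e))) 0
     (ddir e f p + ddir e g p)).
  { intros p. apply (is_derive_plus (fun t => f (plus p (scal t e)))
      (fun t => g (plus p (scal t e)))); apply is_ddir; eapply tame_ex_ddir; eassumption. }
  split. intros p; eexists; apply D.
  match goal with |- tame k ?h => replace h with (fun p => ddir e f p + ddir e g p) end.
  apply IH; apply tame_ddir; assumption.
  apply functional_extensionality; intros p; symmetry; apply is_derive_unique, D.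
Qed.

Lemma tame_mult k f g : tame k f -> tame k g -> tame k (fun p => f p * g p).
Proof.
  revert f g; induction k as [|k IH]; intros f g Hf Hg.
  all: split; [intros p; apply (continuous_mult f g); eapply tame_continuous; eassumption|].
  all: split; [intros T; destruct (tame_bounded _ _ T Hf) as [K HK];
    destruct (tame_bounded _ _ T Hg) as [K' HK']; exists (K * K'); intros x t Ht;
    rewrite Rabs_mult; apply Rmult_le_compat; auto using Rabs_pos|]; auto.
  intros e.
  assert (D : forall p, is_derive (fun t => f (plus p (scal t e)) * g (plus p (scal t e))) 0
     (ddir e f p * g p + f p * ddir e g p)).
  { intros p. 
    assert (E : plus p (scal 0 e) = p) by (rewrite scal_0_l; apply plus_zero_r).
    eapply is_derive_eq.
    apply (is_derive_mult (fun t => f (plus p (scal t e)))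
      (fun t => g (plus p (scal t e))) 0 _ _ 
      (is_ddir _ _ _ (tame_ex_ddir _ _ e p Hf)) (is_ddir _ _ _ (tame_ex_ddir _ _ e p Hg))).
    exact Rmult_comm.
    change (ddir e f p * g (plus p (scal 0 e)) + f (plus p (scal 0 e)) * ddir e g p
      = ddir e f p * g p + f p * ddir e g p). now rewrite E. }
  split. intros p; eexists; apply D.
  match goal with |- tame k ?h => replace h with (fun p => ddir e f p * g p + f p * ddir e g p) end.
  apply tame_plus; apply IH; auto using tame_ddir, tame_weaken.
  apply functional_extensionality; intros p; symmetry; apply is_derive_unique, D.
Qed.

Definition e_t : (R * R) * R := ((0, 0), 1).

Lemma continuous_displaced {V : NormedModule R_AbsRing} (f u : V -> R) (e p : V) :
  continuous u p -> continuous f (plus p (scal (u p) e)) ->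
  continuous (fun q : V => f (plus q (scal (u q) e))) p.
Proof.
  intros Cu Cf. apply (continuous_comp (U := V) (V := V) (fun q : V => plus q (scal (u q) e)) f); [|exact Cf].
  apply (continuous_plus (U := V) (V := V) (fun q : V => q) (fun q : V => scal (u q) e)).
  apply continuous_id. apply (continuous_scal_l (U := V) (V := V) u e), Cu.
Qed.

(** Displacing t by u is how B inherits its bounds from b and u0.  By the chain rule,
the derivative of the composition along e is the displaced ddir e f plus
ddir e u times the displaced derivative of f in t: sums and products of
functions of the same kind. *)
Lemma tame_shift k f u : tame k f -> tame k u ->
  tame k (fun p => f (plus p (scal (u p) e_t))).
Proof.
  revert f; induction k as [|k IH]; intros f Hf Hu.
  all: split; [intros p; refine (continuous_displaced (V := space_time) f u e_t p _ _);
    eapply tame_continuous; eassumption|].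
  all: split; [intros T; destruct (tame_bounded _ _ T Hu) as [K HK];
    destruct (tame_bounded _ _ (T + K) Hf) as [K' HK']; exists K'; intros [x1 x2] t Ht;
    replace (plus (x1, x2, t) (scal (u (x1, x2, t)) e_t)) with (x1, x2, t + u (x1, x2, t));
    [apply HK'; eapply Rle_trans; [apply Rabs_triang|apply Rplus_le_compat; auto]
    |unfold plus, scal, e_t; simpl; unfold prod_plus, prod_scal, plus, scal; simpl;
     unfold plus, scal, mult; simpl; unfold prod_plus, prod_scal, plus, scal; simpl;
     unfold mult; simpl; repeat f_equal; ring]|]; auto.
  intros e.
  assert (D : forall p, is_derive (fun t => f (plus (plus p (scal t e)) (scal (u (plus p (scal t e))) e_t))) 0
     (ddir e f (plus p (scal (u p) e_t)) + ddir e u p * ddir e_t f (plus p (scal (u p) e_t)))).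
  { intros p.
    assert (E : plus p (scal 0 e) = p) by (rewrite scal_0_l; apply plus_zero_r).
    eapply is_derive_ext; [|apply (is_derive_two_directions f _ e_t e
        (fun t => u (plus p (scal t e)) - u p))].
    - intros t. simpl. f_equal. 
      rewrite <- !plus_assoc. f_equal. rewrite plus_comm, <- plus_assoc. f_equal.
      symmetry. etransitivity; [|exact (scal_distr_r (V:=space_time) _ _ e_t)].
      apply (f_equal (fun c : R => scal c e_t)).
      assert (Q : forall x y : R, x = plus (x - y) y) by (intros x y; unfold plus; simpl; ring).
      apply Q.
    - apply filter_forall. intros y; eapply tame_ex_ddir; eassumption.
    - eapply tame_continuous, tame_ddir; eassumption.
    - eapply tame_ex_ddir; eassumption.
    - simpl; rewrite E; ring.
    - replace (ddir e u p) with (ddir e u p - 0) by ring. 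
      apply (is_derive_minus (fun t => u (plus p (scal t e))) (fun _ => u p)).
      apply is_ddir; eapply tame_ex_ddir; eassumption. apply (is_derive_const (u p)). }
  split. intros p; eexists; apply D.
  match goal with |- tame k ?h => replace h with 
    (fun p => ddir e f (plus p (scal (u p) e_t)) + ddir e u p * ddir e_t f (plus p (scal (u p) e_t))) end.
  - apply tame_plus; [|apply tame_mult]; auto using tame_ddir, tame_weaken.
  - apply functional_extensionality; intros p; symmetry; apply is_derive_unique, D.
Qed.

(** * The reaction term along curves *)

Definition e_x1 : (R * R) * R := ((1, 0), 0).
Definition e_x2 : (R * R) * R := ((0, 1), 0).

Notation d_x1 := (ddir e_x1).
Notation d_x2 := (ddir e_x2).
Notation d_t := (ddir e_t).

Ltac unfold_coords :=
  repeat (unfold plus, scal, opp, mult, one; simpl; unfold prod_plus, prod_scal).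

(** Coordinates of vectors live in a type that is only convertible to R, which the
algebraic tactics do not recognise. *)
Ltac ring_R := match goal with |- @eq _ ?u ?v => change (@eq R u v) end; ring.

Ltac field_R := match goal with |- @eq _ ?u ?v => change (@eq R u v) end; field; lra.

Ltac pair_ring := repeat apply (f_equal2 pair); ring_R.

(** Derivative of h -> f (x + h y, a h), as a function of the point p reached. *)
Definition d_path (f : (R * R) * R -> R) (y : R * R) (a' : R) (p : (R * R) * R) : R :=
  fst y * d_x1 f p + snd y * d_x2 f p + a' * d_t f p.

(** Second derivative of the same function, with a' and a'' the derivatives of a. *)
Definition d2_path (f : (R * R) * R -> R) (y : R * R) (a' a'' : R) (p : (R * R) * R) : R :=
  fst y * d_path (d_x1 f) y a' p + snd y * d_path (d_x2 f) y a' p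
  + (a'' * d_t f p + a' * d_path (d_t f) y a' p).

Lemma is_derive_path k f (x y : R * R) a s a' :
  tame (S k) f -> is_derive a s a' ->
  is_derive (fun e => f (plus x (scal e y), a e)) s
    (d_path f y a' (plus x (scal s y), a s)).
Proof.
  intros Hf Ha. apply is_derive_shift.
  set (p := (plus x (scal s y), a s) : space_time).
  set (Y := (y, 0) : space_time).
  assert (HY : ddir Y f p = fst y * d_x1 f p + snd y * d_x2 f p).
  { transitivity (ddir (plus (scal (fst y) e_x1) (scal (snd y) e_x2)) f p).
    - apply (f_equal (fun v : space_time => ddir v f p)).
      destruct y as [y1 y2]. unfold Y, e_x1, e_x2.
      unfold_coords. pair_ring.
    - apply is_derive_unique. apply (is_derive_combination (V := space_time)).
      + apply filter_forall. intros q. exact (tame_ex_ddir _ _ _ _ Hf).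
      + exact (tame_continuous _ _ _ (tame_ddir _ _ _ Hf)).
      + exact (tame_ex_ddir _ _ _ _ Hf). }
  unfold d_path. fold p. rewrite <- HY.
  eapply is_derive_ext; [|apply (is_derive_two_directions (V := space_time) f p e_t Y
       (fun h => a (s + h) - a s) a')].
  - intros h. unfold p, Y, e_t. f_equal. destruct x as [x1 x2], y as [y1 y2].
    unfold_coords. pair_ring.
  - apply filter_forall. intros q. exact (tame_ex_ddir _ _ _ _ Hf).
  - exact (tame_continuous _ _ _ (tame_ddir _ _ _ Hf)).
  - exact (tame_ex_ddir _ _ _ _ Hf).
  - simpl. rewrite Rplus_0_r. ring.
  - apply (is_derive_eq _ _ (1 * a' - 0)); [|ring].
    apply (is_derive_minus (fun h => a (s + h)) (fun _ => a s)).
    + apply (is_derive_comp a (fun h => s + h)).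
      * now rewrite Rplus_0_r.
      * auto_derive; auto; ring.
    + apply (is_derive_const (a s)).
Qed.

Lemma is_derive_d_path k f (x y : R * R) a a1 s a'' :
  tame (S (S k)) f -> is_derive a s (a1 s) -> is_derive a1 s a'' ->
  is_derive (fun e => d_path f y (a1 e) (plus x (scal e y), a e)) s
    (d2_path f y (a1 s) a'' (plus x (scal s y), a s)).
Proof.
  intros Hf Ha Ha1. unfold d_path at 1, d2_path.
  assert (D : forall e, is_derive (fun h => ddir e f (plus x (scal h y), a h)) s
        (d_path (ddir e f) y (a1 s) (plus x (scal s y), a s))).
  { intros e. apply (is_derive_path k); [exact (tame_ddir _ _ _ Hf)|exact Ha]. }
  apply @is_derive_plus; [apply @is_derive_plus|].
  - apply (is_derive_scal (fun h => d_x1 f (plus x (scal h y), a h))), D.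
  - apply (is_derive_scal (fun h => d_x2 f (plus x (scal h y), a h))), D.
  - apply (is_derive_mult a1 (fun h => d_t f (plus x (scal h y), a h))).
    + exact Ha1.
    + apply D.
    + exact Rmult_comm.
Qed.

Lemma is_derive_t k f (x : R * R) t : tame (S k) f -> is_derive (fun s => f (x, s)) t (d_t f (x, t)).
Proof.
  intros Hf.
  assert (D := is_derive_path k f x (0, 0) (fun s => s) t 1 Hf (is_derive_id t)).
  assert (E : forall s : R, plus x (scal s (0, 0)) = x)
    by (intros s; destruct x; unfold_coords; pair_ring).
  apply (is_derive_ext (fun e => f (plus x (scal e (0, 0)), e))).
  { intros s. now rewrite E. }
  eapply is_derive_eq; [exact D|]. rewrite E. unfold d_path; simpl; ring.
Qed.

Definition reaction (b : R * R -> R -> R) (u0 : R * R -> R) (p : (R * R) * R) : R :=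
  B b u0 (fst p) (snd p).

Lemma continuous_fst_gen {U V : UniformSpace} (p : U * V) : continuous fst p.
Proof. destruct p; apply continuous_fst. Qed.

Lemma tame_of_space (u : R * R -> R) :
  smooth_on everywhere u ->
  (forall l : list (R * R), exists M K : R,
    forall x, M <= norm x -> Rabs (ddirs l u x) <= K) ->
  forall k, tame k (fun p => u (fst p)).
Proof.
  intros Su Bu.
  assert (E : forall l : list ((R * R) * R), ddirs l (fun p : space_time => u (fst p))
       = fun p => ddirs (map fst l) u (fst p)).
  { induction l as [|e l IH]; [reflexivity|]. exact (f_equal (ddir e) IH). }
  apply tame_of_bounded_derivatives.
  - intros n l p _. rewrite E. destruct (Su n (map fst l) (fst p) I) as [S1 S2].
    rewrite length_map in S1, S2. split.
    + intros Hl. apply (continuous_comp fst (ddirs (map fst l) u)).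
      * apply continuous_fst_gen.
      * now apply S1.
    + intros Hl e. exact (S2 Hl (fst e)).
  - intros l T. rewrite E. destruct (Bu (map fst l)) as (M & K & H).
    exists M, K. intros x t Hx _. now apply H.
Qed.

Lemma tame_reaction gamma b u0 k : reaction_data gamma b u0 -> tame k (reaction b u0).
Proof.
  intros H.
  replace (reaction b u0) with (fun p : space_time => (fun q : space_time => b (fst q) (snd q))
      (plus p (scal (u0 (fst p)) e_t))).
  - apply (tame_shift k (fun q => b (fst q) (snd q)) (fun p => u0 (fst p))).
    + apply tame_of_bounded_derivatives; [apply H|]. intros l T. apply (b_bounded _ _ _ H).
    + apply tame_of_space; apply H.
  - apply functional_extensionality. intros [[x1 x2] t].
    unfold reaction, B, e_t; unfold_coords. f_equal; pair_ring.
Qed.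

Lemma reaction_0 gamma b u0 x : reaction_data gamma b u0 -> reaction b u0 (x, 0) = 0.
Proof. intros H. unfold reaction, B; simpl. rewrite Rplus_0_r. apply (b_u0 _ _ _ H). Qed.

(** Used to pass from B(x, 0) = 0 to the second x-derivatives of B. *)
Lemma ddir_vanishing f (e : (R * R) * R) x :
  snd e = 0 -> (forall y, f (y, 0) = 0) -> ddir e f (x, 0) = 0.
Proof.
  intros He Hf. unfold ddir.
  rewrite (Derive_ext _ (fun _ => 0)); [apply Derive_const|].
  intros t. destruct e as [y e]; simpl in He; subst e.
  transitivity (f (plus x (scal t y), 0)); [|apply Hf].
  f_equal. unfold_coords. f_equal. pair_ring.
Qed.

Lemma B_t_reaction b u0 x t : (forall k, tame k (reaction b u0)) ->
  B_t b u0 x t = d_t (reaction b u0) (x, t).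
Proof. intros H. exact (is_derive_unique _ _ _ (is_derive_t 0 _ x t (H 1%nat))). Qed.

Lemma grad_B_reaction b u0 x t : (forall k, tame k (reaction b u0)) ->
  grad_B b u0 x t = (d_x1 (reaction b u0) (x, t), d_x2 (reaction b u0) (x, t)).
Proof.
  intros H. unfold grad_B, grad. destruct x as [x1 x2]; simpl.
  assert (D : forall y, is_derive (fun e => reaction b u0 (plus (x1, x2) (scal e y), t)) 0
       (d_path (reaction b u0) y 0 (x1, x2, t))).
  { intros y. eapply is_derive_eq.
    - apply (is_derive_path 0 _ (x1, x2) y (fun _ => t) 0 0 (H 1%nat)).
      apply (is_derive_const t).
    - f_equal. f_equal. destruct y. unfold_coords. pair_ring. }
  f_equal; apply is_derive_unique, is_derive_shift.
  - eapply is_derive_ext; [|eapply is_derive_eq; [apply (D (1, 0))|unfold d_path; simpl; ring]].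
    intros s. unfold reaction; unfold_coords. f_equal. pair_ring.
  - eapply is_derive_ext; [|eapply is_derive_eq; [apply (D (0, 1))|unfold d_path; simpl; ring]].
    intros s. unfold reaction; unfold_coords. f_equal. pair_ring.
Qed.

(** * Interaction of three increments *)

Lemma mean_value_bound (f df : R -> R) (s t K : R) :
  (forall r, is_derive f r (df r)) ->
  (forall r, Rmin s t <= r <= Rmax s t -> Rabs (df r) <= K) ->
  Rabs (f t - f s) <= K * Rabs (t - s).
Proof.
  intros D Hb. destruct (MVT_gen f s t df) as (c & Hc & E).
  - intros; apply D.
  - intros r _. apply continuity_pt_filterlim, (ex_derive_continuous f). eexists; apply D.
  - rewrite E, Rabs_mult. apply Rmult_le_compat_r; [apply Rabs_pos|now apply Hb].
Qed.

Lemma Rabs_le_segment (s t r T : R) :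
  Rmin s t <= r <= Rmax s t -> Rabs s <= T -> Rabs t <= T -> Rabs r <= T.
Proof.
  intros Hr Hs Ht. apply Rabs_le_between in Hs, Ht. apply Rabs_le_between.
  unfold Rmin, Rmax in Hr. destruct (Rle_dec s t); lra.
Qed.

Lemma tame_lipschitz_t k f T : tame (S k) f ->
  exists K, 0 <= K /\ forall x s t, Rabs s <= T -> Rabs t <= T ->
    Rabs (f (x, t) - f (x, s)) <= K * Rabs (t - s).
Proof.
  intros Hf. destruct (tame_bounded _ _ T (tame_ddir _ _ e_t Hf)) as [K HK].
  exists (Rmax 0 K). split; [apply Rmax_l|]. intros x s t Hs Ht.
  apply (mean_value_bound (fun r => f (x, r)) (fun r => d_t f (x, r))).
  - intros r. exact (is_derive_t k f x r Hf).
  - intros r Hr. eapply Rle_trans; [|apply Rmax_r]. apply HK.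
    now apply (Rabs_le_segment s t).
Qed.

Lemma tame_bounded_nonneg k f T : tame k f ->
  exists K, 0 <= K /\ forall x t, Rabs t <= T -> Rabs (f (x, t)) <= K.
Proof.
  intros H; destruct (tame_bounded _ _ T H) as [K HK].
  exists (Rmax 0 K). split; [apply Rmax_l|]. intros x t Ht.
  eapply Rle_trans; [now apply HK|apply Rmax_r].
Qed.

(** The mean value theorem is applied to r -> f (x, r + t) - f (x, r), then to the
derivative of f in t. *)
Lemma tame_second_difference k f T : tame (S (S k)) f ->
  exists K, 0 <= K /\ forall x s t, Rabs s <= T -> Rabs t <= T ->
    Rabs (f (x, s + t) - f (x, s) - f (x, t) + f (x, 0)) <= K * (Rabs s * Rabs t).
Proof.
  intros Hf.
  destruct (tame_lipschitz_t k (d_t f) (2 * T) (tame_ddir _ _ _ Hf)) as (K & K0 & HK).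
  exists K. split; [exact K0|]. intros x s t Hs Ht.
  assert (D := fun r => is_derive_t (S k) f x r Hf).
  replace (f (x, s + t) - f (x, s) - f (x, t) + f (x, 0))
    with ((f (x, s + t) - f (x, s)) - (f (x, 0 + t) - f (x, 0))) by (rewrite Rplus_0_l; ring).
  replace (K * (Rabs s * Rabs t)) with (K * Rabs t * Rabs (s - 0)) by (rewrite Rminus_0_r; ring).
  apply (mean_value_bound (fun r => f (x, r + t) - f (x, r))
      (fun r => d_t f (x, r + t) - d_t f (x, r))).
  - intros r. apply @is_derive_minus; [|apply D].
    apply (is_derive_eq _ _ (1 * d_t f (x, r + t))); [|ring].
    apply (is_derive_comp (fun q => f (x, q)) (fun q => q + t)); [apply D|].
    auto_derive; auto; ring.
  - intros r Hr.
    assert (Hr' : Rabs r <= T).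
    { apply (Rabs_le_segment 0 s); auto. rewrite Rabs_R0.
      eapply Rle_trans; [apply Rabs_pos|exact Hs]. }
    assert (h := Rabs_triang r t).
    eapply Rle_trans; [apply HK|right; f_equal; f_equal; ring]; assert (q := Rabs_pos r); lra.
Qed.

(** Three increments of sizes E1, E2 (the two boundary layers) and E3 (the corner
layer).  Since f (x, 0) = 0, dropping c leaves a mixed second difference in
a and b, of the size of their product. *)
Lemma interaction_bound_vanishing f C : tame 2 f -> (forall x, f (x, 0) = 0) -> 0 <= C ->
  exists K, 0 <= K /\ forall x a b c E1 E2 E3,
    0 <= E1 <= 1 -> 0 <= E2 <= 1 -> 0 <= E3 <= 1 ->
    Rabs a <= C * E1 -> Rabs b <= C * E2 -> Rabs c <= C * E3 ->
    Rabs (f (x, a + b + c) - f (x, a) - f (x, b)) <= K * (E1 * E2 + E3).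
Proof.
  intros Hf f0 HC.
  destruct (tame_lipschitz_t 1 f (3 * C) Hf) as (K1 & K1p & H1).
  destruct (tame_second_difference 0 f C Hf) as (K2 & K2p & H2).
  exists (K1 * C + K2 * (C * C)). split; [nra|].
  intros x a b c E1 E2 E3 h1 h2 h3 Ha Hb Hc.
  assert (a1 : Rabs a <= C) by nra. assert (b1 : Rabs b <= C) by nra.
  assert (c1 : Rabs c <= C) by nra.
  assert (t1 := Rabs_triang a b). assert (t2 := Rabs_triang (a + b) c).
  specialize (H1 x (a + b) (a + b + c) ltac:(lra) ltac:(lra)).
  specialize (H2 x a b a1 b1). rewrite f0 in H2.
  replace (a + b + c - (a + b)) with c in H1 by ring.
  replace (f (x, a + b + c) - f (x, a) - f (x, b))
    with ((f (x, a + b + c) - f (x, a + b)) + (f (x, a + b) - f (x, a) - f (x, b) + 0)) by ring.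
  eapply Rle_trans; [apply Rabs_triang|].
  assert (p1 : K1 * Rabs c <= K1 * C * E3).
  { rewrite Rmult_assoc. now apply Rmult_le_compat_l. }
  assert (p2 : Rabs a * Rabs b <= (C * E1) * (C * E2))
    by (apply Rmult_le_compat; auto using Rabs_pos).
  assert (p3 : K2 * (Rabs a * Rabs b) <= K2 * ((C * E1) * (C * E2)))
    by now apply Rmult_le_compat_l.
  assert (p4 : 0 <= K1 * C * (E1 * E2)) by (repeat apply Rmult_le_pos; lra).
  assert (p5 : 0 <= K2 * (C * C) * E3) by (repeat apply Rmult_le_pos; lra).
  lra.
Qed.

(** The difference is wa (f(a+b+c) - f(a)) + wb (f(a+b+c) - f(b)) plus the excess
weight times f(a+b+c).  In the first two terms the weight brings the decay of
one layer and the difference that of the others. *)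
Lemma interaction_bound_weighted f C : tame 1 f -> 0 <= C ->
  exists K, 0 <= K /\ forall x a b c wa wb w W E1 E2 E3,
    0 <= E1 <= 1 -> 0 <= E2 <= 1 -> 0 <= E3 <= 1 -> 0 <= W ->
    Rabs a <= C * E1 -> Rabs b <= C * E2 -> Rabs c <= C * E3 ->
    Rabs wa <= W * E1 -> Rabs wb <= W * E2 -> Rabs (w - wa - wb) <= W * (E1 * E2 + E3) ->
    Rabs (w * f (x, a + b + c) - wa * f (x, a) - wb * f (x, b)) <= K * (W * (E1 * E2 + E3)).
Proof.
  intros Hf HC.
  destruct (tame_lipschitz_t 0 f (3 * C) Hf) as (K1 & K1p & H1).
  destruct (tame_bounded_nonneg 1 f (3 * C) Hf) as (K2 & K2p & H2).
  exists (2 * (K1 * C) + K2). split; [nra|].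
  intros x a b c wa wb w W E1 E2 E3 h1 h2 h3 HW Ha Hb Hc Hwa Hwb Hw.
  assert (a1 : Rabs a <= C) by nra. assert (b1 : Rabs b <= C) by nra.
  assert (c1 : Rabs c <= C) by nra.
  assert (t1 := Rabs_triang a b). assert (t2 := Rabs_triang (a + b) c).
  assert (Da : Rabs (f (x, a + b + c) - f (x, a)) <= K1 * C * (E2 + E3)).
  { eapply Rle_trans; [apply H1; lra|]. rewrite Rmult_assoc. apply Rmult_le_compat_l; [lra|].
    replace (a + b + c - a) with (b + c) by ring.
    eapply Rle_trans; [apply Rabs_triang|lra]. }
  assert (Db : Rabs (f (x, a + b + c) - f (x, b)) <= K1 * C * (E1 + E3)).
  { eapply Rle_trans; [apply H1; lra|]. rewrite Rmult_assoc. apply Rmult_le_compat_l; [lra|].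
    replace (a + b + c - b) with (a + c) by ring.
    eapply Rle_trans; [apply Rabs_triang|lra]. }
  assert (Df : Rabs (f (x, a + b + c)) <= K2) by (apply H2; lra).
  replace (w * f (x, a + b + c) - wa * f (x, a) - wb * f (x, b))
    with (wa * (f (x, a + b + c) - f (x, a)) + wb * (f (x, a + b + c) - f (x, b))
          + (w - wa - wb) * f (x, a + b + c)) by ring.
  assert (ka : 0 <= K1 * C) by nra.
  assert (P1 : Rabs (wa * (f (x, a + b + c) - f (x, a))) <= (W * E1) * (K1 * C * (E2 + E3)))
    by (rewrite Rabs_mult; apply Rmult_le_compat; auto using Rabs_pos).
  assert (P2 : Rabs (wb * (f (x, a + b + c) - f (x, b))) <= (W * E2) * (K1 * C * (E1 + E3)))
    by (rewrite Rabs_mult; apply Rmult_le_compat; auto using Rabs_pos).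
  assert (P3 : Rabs ((w - wa - wb) * f (x, a + b + c)) <= (W * (E1 * E2 + E3)) * K2)
    by (rewrite Rabs_mult; apply Rmult_le_compat; auto using Rabs_pos).
  eapply Rle_trans; [apply Rabs_triang|].
  eapply Rle_trans; [apply Rplus_le_compat_r, Rabs_triang|].
  assert (Q1 : (W * (K1 * C)) * (E1 * E3) <= (W * (K1 * C)) * E3)
    by (apply Rmult_le_compat_l; nra).
  assert (Q2 : (W * (K1 * C)) * (E2 * E3) <= (W * (K1 * C)) * E3)
    by (apply Rmult_le_compat_l; nra).
  lra.
Qed.

Lemma Rabs_plus_le {u v M N : R} : Rabs u <= M -> Rabs v <= N -> Rabs (u + v) <= M + N.
Proof. intros Hu Hv. eapply Rle_trans; [apply Rabs_triang|lra]. Qed.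

(** The second derivative of the interaction function phi of the introduction.
It is quadratic in (y, a', ...): the coefficients multiplying y_i y_j alone
vanish at t = 0, and the other ones come with weights y_i a', a'^2 or a'',
which decay. *)
Lemma corner_interaction_bound f C : tame 4 f -> (forall x, f (x, 0) = 0) -> 0 <= C ->
  exists K, 0 <= K /\ forall (x y : R * R) a b c a1 b1 c1 a2 b2 c2 W E1 E2 E3,
    0 <= E1 <= 1 -> 0 <= E2 <= 1 -> 0 <= E3 <= 1 -> 1 <= W -> norm y <= W ->
    Rabs a <= C * E1 -> Rabs b <= C * E2 -> Rabs c <= C * E3 ->
    Rabs a1 <= W * E1 -> Rabs b1 <= W * E2 -> Rabs c1 <= W * E3 ->
    Rabs a2 <= W * E1 -> Rabs b2 <= W * E2 -> Rabs c2 <= W * E3 ->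
    Rabs (d2_path f y (a1 + b1 + c1) (a2 + b2 + c2) (x, a + b + c)
          - d2_path f y a1 a2 (x, a) - d2_path f y b1 b2 (x, b))
    <= K * (W ^ 2 * (E1 * E2 + E3)).
Proof.
  intros Hf f0 HC.
  assert (V1 : forall e e', snd e = 0 -> snd e' = 0 -> forall x, ddir e (ddir e' f) (x, 0) = 0)
    by (intros; apply ddir_vanishing; auto; intros; apply ddir_vanishing; auto).
  assert (T2 : forall e e', tame 2 (ddir e (ddir e' f)))
    by (intros; do 2 apply tame_ddir; exact Hf).
  assert (T1 : forall e e', tame 1 (ddir e (ddir e' f)))
    by (intros; apply tame_weaken, T2).
  assert (T1' : tame 1 (d_t f)) by (do 2 apply tame_weaken; apply tame_ddir, Hf).
  destruct (interaction_bound_vanishing _ C (T2 e_x1 e_x1) (V1 e_x1 e_x1 eq_refl eq_refl) HC)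
    as (K11 & p11 & H11).
  destruct (interaction_bound_vanishing _ C (T2 e_x1 e_x2) (V1 e_x1 e_x2 eq_refl eq_refl) HC)
    as (K12 & p12 & H12).
  destruct (interaction_bound_vanishing _ C (T2 e_x2 e_x1) (V1 e_x2 e_x1 eq_refl eq_refl) HC)
    as (K21 & p21 & H21).
  destruct (interaction_bound_vanishing _ C (T2 e_x2 e_x2) (V1 e_x2 e_x2 eq_refl eq_refl) HC)
    as (K22 & p22 & H22).
  destruct (interaction_bound_weighted _ C (T1 e_x1 e_t) HC) as (K1t & p1t & H1t).
  destruct (interaction_bound_weighted _ C (T1 e_t e_x1) HC) as (Kt1 & pt1 & Ht1).
  destruct (interaction_bound_weighted _ C (T1 e_x2 e_t) HC) as (K2t & p2t & H2t).
  destruct (interaction_bound_weighted _ C (T1 e_t e_x2) HC) as (Kt2 & pt2 & Ht2).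
  destruct (interaction_bound_weighted _ C (T1 e_t e_t) HC) as (Ktt & ptt & Htt).
  destruct (interaction_bound_weighted _ C T1' HC) as (Kt & pt & Ht).
  exists (K11 + K12 + K21 + K22 + 5 * (K1t + Kt1 + K2t + Kt2 + Ktt + Kt)). split; [lra|].
  intros x y a b c a1 b1 c1 a2 b2 c2 W E1 E2 E3 h1 h2 h3 HW Hy Ha Hb Hc Ha1 Hb1 Hc1 Ha2 Hb2 Hc2.
  specialize (H11 x a b c E1 E2 E3 h1 h2 h3 Ha Hb Hc).
  specialize (H12 x a b c E1 E2 E3 h1 h2 h3 Ha Hb Hc).
  specialize (H21 x a b c E1 E2 E3 h1 h2 h3 Ha Hb Hc).
  specialize (H22 x a b c E1 E2 E3 h1 h2 h3 Ha Hb Hc).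
  assert (y1 : Rabs (fst y) <= W) by (eapply Rle_trans; [apply Rabs_fst_le_norm|exact Hy]).
  assert (y2 : Rabs (snd y) <= W) by (eapply Rle_trans; [apply Rabs_snd_le_norm|exact Hy]).
  assert (eE : 0 <= E1 * E2) by (apply Rmult_le_pos; lra).
  (* 5 W^2 bounds all the weights; the 5 comes from the square of a1 + b1 + c1, whose
     excess 2 a1 b1 + c1 (2 a1 + 2 b1 + c1) has a bracket bounded by 5 W. *)
  assert (W2 : 0 <= 5 * W ^ 2) by nra.
  assert (WW : W <= 5 * W ^ 2) by nra.
  assert (L1 : forall z d E, Rabs z <= W -> 0 <= E -> Rabs d <= W * E -> Rabs (z * d) <= 5 * W ^ 2 * E).
  { intros z d E Hz HE Hd. rewrite Rabs_mult.
    apply Rle_trans with (W * (W * E)); [apply Rmult_le_compat; auto using Rabs_pos|].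
    assert (0 <= W ^ 2 * E) by (apply Rmult_le_pos; nra). nra. }
  assert (L2 : forall d E, 0 <= E -> Rabs d <= W * E -> Rabs d <= 5 * W ^ 2 * E).
  { intros d E HE Hd. eapply Rle_trans; [exact Hd|]. now apply Rmult_le_compat_r. }
  assert (L3 : forall d, Rabs d <= 5 * W ^ 2 * E3 -> Rabs d <= 5 * W ^ 2 * (E1 * E2 + E3)).
  { intros d Hd. eapply Rle_trans; [exact Hd|]. apply Rmult_le_compat_l; lra. }
  assert (wx : forall z, Rabs z <= W ->
     Rabs (z * (a1 + b1 + c1) - z * a1 - z * b1) <= 5 * W ^ 2 * (E1 * E2 + E3)).
  { intros z Hz. apply L3. replace (z * (a1 + b1 + c1) - z * a1 - z * b1) with (z * c1) by ring.
    apply L1; auto; lra. }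
  assert (wt : Rabs ((a2 + b2 + c2) - a2 - b2) <= 5 * W ^ 2 * (E1 * E2 + E3)).
  { apply L3. replace ((a2 + b2 + c2) - a2 - b2) with c2 by ring. apply L2; auto; lra. }
  assert (S1 : forall d E, 0 <= E <= 1 -> Rabs d <= W * E -> Rabs d <= W).
  { intros d E HE Hd. nra. }
  assert (A1 := S1 _ _ h1 Ha1). assert (B1 := S1 _ _ h2 Hb1). assert (C1 := S1 _ _ h3 Hc1).
  assert (wtt : Rabs ((a1 + b1 + c1) * (a1 + b1 + c1) - a1 * a1 - b1 * b1)
     <= 5 * W ^ 2 * (E1 * E2 + E3)).
  { replace ((a1 + b1 + c1) * (a1 + b1 + c1) - a1 * a1 - b1 * b1)
      with (2 * (a1 * b1) + c1 * (2 * a1 + 2 * b1 + c1)) by ring.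
    eapply Rle_trans; [apply Rabs_triang|]. rewrite !Rabs_mult, (Rabs_pos_eq 2) by lra.
    assert (q1 : Rabs a1 * Rabs b1 <= (W * E1) * (W * E2))
      by (apply Rmult_le_compat; auto using Rabs_pos).
    assert (q2 : Rabs (2 * a1 + 2 * b1 + c1) <= 5 * W).
    { eapply Rle_trans; [apply Rabs_triang|].
      eapply Rle_trans; [apply Rplus_le_compat_r, Rabs_triang|].
      rewrite !Rabs_mult, (Rabs_pos_eq 2) by lra. lra. }
    assert (q3 : Rabs c1 * Rabs (2 * a1 + 2 * b1 + c1) <= (W * E3) * (5 * W))
      by (apply Rmult_le_compat; auto using Rabs_pos).
    assert (0 <= W ^ 2 * (E1 * E2)) by (apply Rmult_le_pos; nra). nra. }
  specialize (H1t x a b c (fst y * a1) (fst y * b1) (fst y * (a1 + b1 + c1)) (5 * W ^ 2) E1 E2 E3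
    h1 h2 h3 W2 Ha Hb Hc (L1 _ _ _ y1 (proj1 h1) Ha1) (L1 _ _ _ y1 (proj1 h2) Hb1) (wx _ y1)).
  specialize (Ht1 x a b c (fst y * a1) (fst y * b1) (fst y * (a1 + b1 + c1)) (5 * W ^ 2) E1 E2 E3
    h1 h2 h3 W2 Ha Hb Hc (L1 _ _ _ y1 (proj1 h1) Ha1) (L1 _ _ _ y1 (proj1 h2) Hb1) (wx _ y1)).
  specialize (H2t x a b c (snd y * a1) (snd y * b1) (snd y * (a1 + b1 + c1)) (5 * W ^ 2) E1 E2 E3
    h1 h2 h3 W2 Ha Hb Hc (L1 _ _ _ y2 (proj1 h1) Ha1) (L1 _ _ _ y2 (proj1 h2) Hb1) (wx _ y2)).
  specialize (Ht2 x a b c (snd y * a1) (snd y * b1) (snd y * (a1 + b1 + c1)) (5 * W ^ 2) E1 E2 E3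
    h1 h2 h3 W2 Ha Hb Hc (L1 _ _ _ y2 (proj1 h1) Ha1) (L1 _ _ _ y2 (proj1 h2) Hb1) (wx _ y2)).
  specialize (Htt x a b c (a1 * a1) (b1 * b1) ((a1 + b1 + c1) * (a1 + b1 + c1)) (5 * W ^ 2) E1 E2 E3
    h1 h2 h3 W2 Ha Hb Hc (L1 _ _ _ A1 (proj1 h1) Ha1) (L1 _ _ _ B1 (proj1 h2) Hb1) wtt).
  specialize (Ht x a b c a2 b2 (a2 + b2 + c2) (5 * W ^ 2) E1 E2 E3
    h1 h2 h3 W2 Ha Hb Hc (L2 _ _ (proj1 h1) Ha2) (L2 _ _ (proj1 h2) Hb2) wt).
  set (Q := E1 * E2 + E3) in *.
  assert (HQ : 0 <= Q) by (unfold Q; lra).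
  assert (L4 : forall z z' d K, 0 <= K -> Rabs z <= W -> Rabs z' <= W -> Rabs d <= K * Q ->
     Rabs (z * z' * d) <= K * (W ^ 2 * Q)).
  { intros z z' d K HK Hz Hz' Hd. rewrite !Rabs_mult.
    apply Rle_trans with (W * W * (K * Q)); [|right; ring].
    apply Rmult_le_compat; auto using Rabs_pos.
    - apply Rmult_le_pos; apply Rabs_pos.
    - apply Rmult_le_compat; auto using Rabs_pos. }
  apply (L4 (fst y) (fst y)) in H11; auto.
  apply (L4 (fst y) (snd y)) in H12; auto.
  apply (L4 (snd y) (fst y)) in H21; auto.
  apply (L4 (snd y) (snd y)) in H22; auto.
  unfold d2_path, d_path.
  match goal with |- Rabs ?z <= _ => replace z with
   ((fst y * fst y * (d_x1 (d_x1 f) (x, a + b + c) - d_x1 (d_x1 f) (x, a) - d_x1 (d_x1 f) (x, b)))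
   + (fst y * snd y * (d_x1 (d_x2 f) (x, a + b + c) - d_x1 (d_x2 f) (x, a) - d_x1 (d_x2 f) (x, b)))
   + (snd y * fst y * (d_x2 (d_x1 f) (x, a + b + c) - d_x2 (d_x1 f) (x, a) - d_x2 (d_x1 f) (x, b)))
   + (snd y * snd y * (d_x2 (d_x2 f) (x, a + b + c) - d_x2 (d_x2 f) (x, a) - d_x2 (d_x2 f) (x, b)))
   + (fst y * (a1 + b1 + c1) * d_x1 (d_t f) (x, a + b + c)
      - fst y * a1 * d_x1 (d_t f) (x, a) - fst y * b1 * d_x1 (d_t f) (x, b))
   + (fst y * (a1 + b1 + c1) * d_t (d_x1 f) (x, a + b + c)
      - fst y * a1 * d_t (d_x1 f) (x, a) - fst y * b1 * d_t (d_x1 f) (x, b))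
   + (snd y * (a1 + b1 + c1) * d_x2 (d_t f) (x, a + b + c)
      - snd y * a1 * d_x2 (d_t f) (x, a) - snd y * b1 * d_x2 (d_t f) (x, b))
   + (snd y * (a1 + b1 + c1) * d_t (d_x2 f) (x, a + b + c)
      - snd y * a1 * d_t (d_x2 f) (x, a) - snd y * b1 * d_t (d_x2 f) (x, b))
   + ((a1 + b1 + c1) * (a1 + b1 + c1) * d_t (d_t f) (x, a + b + c)
      - a1 * a1 * d_t (d_t f) (x, a) - b1 * b1 * d_t (d_t f) (x, b))
   + ((a2 + b2 + c2) * d_t f (x, a + b + c) - a2 * d_t f (x, a) - b2 * d_t f (x, b))) by ring end.
  eapply Rle_trans; [exact (Rabs_plus_le (Rabs_plus_le (Rabs_plus_le (Rabs_plus_le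
    (Rabs_plus_le (Rabs_plus_le (Rabs_plus_le (Rabs_plus_le (Rabs_plus_le H11 H12) H21) H22)
    H1t) Ht1) H2t) Ht2) Htt) Ht)|].
  right; ring.
Qed.

(** * Boundary layers *)

Notation e_1 := ((1, 0) : R * R).
Notation e_2 := ((0, 1) : R * R).
Notation d_1 := (ddir e_1).
Notation d_2 := (ddir e_2).

Lemma plus_scal_e_1 (x y t : R) : plus (x, y) (scal t e_1) = (x + t, y).
Proof. unfold_coords. pair_ring. Qed.

Lemma plus_scal_e_2 (x y t : R) : plus (x, y) (scal t e_2) = (x, y + t).
Proof. unfold_coords. pair_ring. Qed.

Lemma Derive_shift (f : R -> R) t : Derive f t = Derive (fun h => f (t + h)) 0.
Proof.
  unfold Derive. f_equal. apply Lim_ext. intros h. rewrite Rplus_0_l, Rplus_0_r. reflexivity.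
Qed.

Lemma Derive_fst (f : R * R -> R) (x y : R) : Derive (fun t => f (t, y)) x = d_1 f (x, y).
Proof.
  rewrite Derive_shift. apply Derive_ext. intros t. now rewrite plus_scal_e_1.
Qed.

Lemma Derive_snd (f : R * R -> R) (x y : R) : Derive (fun t => f (x, t)) y = d_2 f (x, y).
Proof.
  rewrite Derive_shift. apply Derive_ext. intros t. now rewrite plus_scal_e_2.
Qed.

Lemma Derive_n_fst (f : R * R -> R) (x y : R) : Derive_n (fun t => f (t, y)) 2 x = d_1 (d_1 f) (x, y).
Proof.
  simpl. rewrite <- Derive_fst. apply Derive_ext. intros t. apply Derive_fst.
Qed.

Lemma Derive_n_snd (f : R * R -> R) (x y : R) : Derive_n (fun t => f (x, t)) 2 y = d_2 (d_2 f) (x, y).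
Proof.
  simpl. rewrite <- Derive_snd. apply Derive_ext. intros t. apply Derive_snd.
Qed.

(** Both sides are limits of the same quotients, so this holds for every f. *)
Lemma laplacian_ddir (f : R * R -> R) (x : R * R) : laplacian f x = d_1 (d_1 f) x + d_2 (d_2 f) x.
Proof.
  unfold laplacian. destruct x as [x1 x2]. cbn [fst snd].
  now rewrite Derive_n_fst, Derive_n_snd.
Qed.

Lemma is_derive_fst (f : R * R -> R) (x y : R) :
  ex_ddir e_1 f (x, y) -> is_derive (fun t => f (t, y)) x (d_1 f (x, y)).
Proof.
  intros H. apply is_derive_shift.
  apply (is_derive_ext (fun t => f (plus (x, y) (scal t e_1)))).
  - intros t. now rewrite plus_scal_e_1.
  - exact (is_ddir _ _ _ H).
Qed.

Lemma is_derive_snd (f : R * R -> R) (x y : R) :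
  ex_ddir e_2 f (x, y) -> is_derive (fun t => f (x, t)) y (d_2 f (x, y)).
Proof.
  intros H. apply is_derive_shift.
  apply (is_derive_ext (fun t => f (plus (x, y) (scal t e_2)))).
  - intros t. now rewrite plus_scal_e_2.
  - exact (is_ddir _ _ _ H).
Qed.

Notation half_plane := (fun p : R * R => 0 < fst p).

Lemma smooth_ex_ddir {V : NormedModule R_AbsRing} D (f : V -> R) l e x :
  smooth_on D f -> D x -> ex_ddir e (ddirs l f) x.
Proof. intros S Hx. apply (proj2 (S (Datatypes.S (length l)) l x Hx)), le_n. Qed.

Lemma smooth_continuous {V : NormedModule R_AbsRing} D (f : V -> R) l x :
  smooth_on D f -> D x -> continuous (ddirs l f) x.
Proof. intros S Hx. apply (proj1 (S (length l) l x Hx)), le_n. Qed.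

Lemma smooth_ddir {V : NormedModule R_AbsRing} D (f : V -> R) e :
  smooth_on D f -> smooth_on D (ddir e f).
Proof.
  intros S n l x Hx.
  assert (E : ddirs l (ddir e f) = ddirs (l ++ [e]) f).
  { induction l as [|e' l IH]; [reflexivity|]. exact (f_equal (ddir e') IH). }
  rewrite E. destruct (S (Datatypes.S n) (l ++ [e]) x Hx) as [S1 S2].
  rewrite length_app in S1, S2. simpl in S1, S2. rewrite PeanoNat.Nat.add_1_r in S1, S2.
  split; intros H.
  - apply S1. now apply le_n_S.
  - apply S2. now apply le_n_S.
Qed.

Lemma half_plane_open (p : R * R) : 0 < fst p -> locally p half_plane.
Proof.
  destruct p as [p1 p2]. cbn [fst]. intros Hp. exists (mkposreal _ Hp). intros [q1 q2] [Hq _].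
  change (Rabs (q1 - p1) < p1) in Hq. apply Rabs_lt_between in Hq. cbn [fst].
  change (0 < q1). lra.
Qed.

Lemma ddir_commute (f : R * R -> R) (x y : R) :
  smooth_on half_plane f -> 0 < x -> d_1 (d_2 f) (x, y) = d_2 (d_1 f) (x, y).
Proof.
  intros S Hx.
  assert (E12 : forall u v, Derive (fun z => Derive (fun t => f (z, t)) v) u = d_1 (d_2 f) (u, v)).
  { intros u v. rewrite <- Derive_fst. apply Derive_ext. intros t. apply Derive_snd. }
  assert (E21 : forall u v, Derive (fun z => Derive (fun t => f (t, z)) u) v = d_2 (d_1 f) (u, v)).
  { intros u v. rewrite <- Derive_snd. apply Derive_ext. intros t. apply Derive_fst. }
  rewrite <- E12, <- E21. apply (Schwarz (fun u v => f (u, v))).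
  - apply locally_2d_locally. destruct (half_plane_open (x, y) Hx) as [d Hd]. exists d.
    intros [u v] Huv. assert (Hu := Hd (u, v) Huv : 0 < u). repeat split.
    + eexists. apply is_derive_fst. now apply (smooth_ex_ddir half_plane f []).
    + eexists. apply is_derive_snd. now apply (smooth_ex_ddir half_plane f []).
    + eexists. eapply is_derive_ext; [intros t; symmetry; apply Derive_snd|].
      apply is_derive_fst. now apply (smooth_ex_ddir half_plane f [e_2]).
    + eexists. eapply is_derive_ext; [intros t; symmetry; apply Derive_fst|].
      apply is_derive_snd. now apply (smooth_ex_ddir half_plane f [e_1]).
  - apply continuity_2d_pt_filterlim.
    refine (continuous_ext (d_1 (d_2 f)) _ (x, y) _ _); [intros [u v]; symmetry; apply E12|].
    now apply (smooth_continuous half_plane f [e_1; e_2]).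
  - apply continuity_2d_pt_filterlim.
    refine (continuous_ext (d_2 (d_1 f)) _ (x, y) _ _); [intros [u v]; symmetry; apply E21|].
    now apply (smooth_continuous half_plane f [e_2; e_1]).
Qed.

Lemma Derive_ext_pos (f g : R -> R) x : 0 < x -> (forall t, 0 < t -> f t = g t) ->
  Derive f x = Derive g x.
Proof.
  intros Hx H. apply Derive_ext_loc. exists (mkposreal _ Hx). intros t Ht.
  change (Rabs (t - x) < x) in Ht. apply Rabs_lt_between in Ht. apply H. lra.
Qed.

(** Lets the equation of v0, which holds for all s, be differentiated in s. *)
Lemma ddir_commute_twice (f : R * R -> R) (x y : R) :
  smooth_on half_plane f -> 0 < x -> d_1 (d_1 (d_2 f)) (x, y) = d_2 (d_1 (d_1 f)) (x, y).
Proof.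
  intros S Hx. rewrite <- ddir_commute; [|now apply smooth_ddir|exact Hx].
  rewrite <- !(Derive_fst _ x). apply Derive_ext_pos; [exact Hx|].
  intros t Ht. now apply ddir_commute.
Qed.

(** The boundary layer at a fixed point of the stretched plane, as a function of the
small parameter e: the unstretched abscissa is e sigma. *)
Definition layer_path (v0 v1 : R * R -> R) (xi sigma e : R) : R :=
  v0 (xi, e * sigma) + e * v1 (xi, e * sigma).

Definition layer_path_d1 (v0 v1 : R * R -> R) (xi sigma e : R) : R :=
  sigma * d_2 v0 (xi, e * sigma) + v1 (xi, e * sigma) + e * (sigma * d_2 v1 (xi, e * sigma)).

Definition layer_path_d2 (v0 v1 : R * R -> R) (xi sigma e : R) : R :=
  sigma ^ 2 * d_2 (d_2 v0) (xi, e * sigma) + 2 * sigma * d_2 v1 (xi, e * sigma)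
  + e * (sigma ^ 2 * d_2 (d_2 v1) (xi, e * sigma)).

Lemma is_derive_snd_scaled (f : R * R -> R) (xi sigma e : R) :
  smooth_on half_plane f -> 0 < xi ->
  is_derive (fun h => f (xi, h * sigma)) e (sigma * d_2 f (xi, e * sigma)).
Proof.
  intros S Hxi. apply (is_derive_comp (fun t => f (xi, t)) (fun h => h * sigma)).
  - apply is_derive_snd. now apply (smooth_ex_ddir half_plane f []).
  - auto_derive; auto; ring.
Qed.

Lemma is_derive_layer_path (v0 v1 : R * R -> R) (xi sigma e : R) :
  smooth_on half_plane v0 -> smooth_on half_plane v1 -> 0 < xi ->
  is_derive (layer_path v0 v1 xi sigma) e (layer_path_d1 v0 v1 xi sigma e).
Proof.
  intros S0 S1 Hxi. unfold layer_path, layer_path_d1. eapply is_derive_eq.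
  - apply @is_derive_plus; [now apply is_derive_snd_scaled|].
    apply (is_derive_mult (fun h => h) (fun h => v1 (xi, h * sigma)));
      [apply is_derive_id|now apply is_derive_snd_scaled|exact Rmult_comm].
  - unfold plus, mult, one; simpl. ring.
Qed.

Lemma is_derive_layer_path_d1 (v0 v1 : R * R -> R) (xi sigma e : R) :
  smooth_on half_plane v0 -> smooth_on half_plane v1 -> 0 < xi ->
  is_derive (layer_path_d1 v0 v1 xi sigma) e (layer_path_d2 v0 v1 xi sigma e).
Proof.
  intros S0 S1 Hxi. unfold layer_path_d1, layer_path_d2. eapply is_derive_eq.
  - apply @is_derive_plus; [apply @is_derive_plus|].
    + apply is_derive_scal, is_derive_snd_scaled; [now apply smooth_ddir|exact Hxi].
    + now apply is_derive_snd_scaled.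
    + apply (is_derive_mult (fun h => h) (fun h => sigma * d_2 v1 (xi, h * sigma)));
      [apply is_derive_id| |exact Rmult_comm].
      apply is_derive_scal, is_derive_snd_scaled; [now apply smooth_ddir|exact Hxi].
  - unfold plus, mult, one; simpl. ring.
Qed.

Lemma layer_decay {gamma b u0 e r gl v0 v1}
    (hb : reaction_data gamma b u0) (hv : boundary_layer gamma b u0 e r gl v0 v1) :
  exists K, 0 <= K /\ forall xi s, 0 < xi ->
    Rabs (v0 (xi, s)) <= K * exp (- (gamma / 2) * xi) /\
    Rabs (v1 (xi, s)) <= K * exp (- (gamma / 2) * xi) /\
    Rabs (d_2 v0 (xi, s)) <= K * exp (- (gamma / 2) * xi) /\
    Rabs (d_2 v1 (xi, s)) <= K * exp (- (gamma / 2) * xi) /\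
    Rabs (d_2 (d_2 v0) (xi, s)) <= K * exp (- (gamma / 2) * xi) /\
    Rabs (d_2 (d_2 v1) (xi, s)) <= K * exp (- (gamma / 2) * xi).
Proof.
  assert (g0 := gamma_pos _ _ _ hb).
  destruct (v_decay _ _ _ _ _ _ _ _ hv 0 (gamma / 2) ltac:(lra)) as [K0 H0].
  destruct (v_decay _ _ _ _ _ _ _ _ hv 1 (gamma / 2) ltac:(lra)) as [K1 H1].
  destruct (v_decay _ _ _ _ _ _ _ _ hv 2 (gamma / 2) ltac:(lra)) as [K2 H2].
  set (K := Rmax 0 (Rmax K0 (Rmax K1 K2))).
  assert (k0 : K0 <= K) by (eapply Rle_trans; [apply Rmax_l|apply Rmax_r]).
  assert (k12 : Rmax K1 K2 <= K) by (eapply Rle_trans; [apply Rmax_r|apply Rmax_r]).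
  assert (k1 : K1 <= K) by (eapply Rle_trans; [apply Rmax_l|exact k12]).
  assert (k2 : K2 <= K) by (eapply Rle_trans; [apply Rmax_r|exact k12]).
  exists K. split; [apply Rmax_l|]. intros xi s Hxi.
  specialize (H0 xi s Hxi). specialize (H1 xi s Hxi). specialize (H2 xi s Hxi).
  rewrite !Derive_n_snd in H2.
  change (Derive_n (fun t => v0 (xi, t)) 1 s) with (Derive (fun t => v0 (xi, t)) s) in H1.
  change (Derive_n (fun t => v1 (xi, t)) 1 s) with (Derive (fun t => v1 (xi, t)) s) in H1.
  rewrite !Derive_snd in H1. cbn [Derive_n] in H0.
  replace (gamma - gamma / 2) with (gamma / 2) in * by lra.
  assert (ep := exp_pos (- (gamma / 2) * xi)). set (E := exp (- (gamma / 2) * xi)) in *.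
  assert (l0 : K0 * E <= K * E) by (apply Rmult_le_compat_r; lra).
  assert (l1 : K1 * E <= K * E) by (apply Rmult_le_compat_r; lra).
  assert (l2 : K2 * E <= K * E) by (apply Rmult_le_compat_r; lra).
  repeat match goal with
  | H : context [Rabs ?z] |- _ => lazymatch goal with
     | _ : 0 <= Rabs z |- _ => fail | _ => assert (0 <= Rabs z) by apply Rabs_pos end end.
  repeat split; lra.
Qed.

Lemma layer_path_bounds {gamma b u0 e r gl v0 v1}
    (hb : reaction_data gamma b u0)
    (hv : boundary_layer gamma b u0 e r gl v0 v1) :
  exists K, 0 <= K /\ forall xi sigma h, 0 < xi -> 0 <= h <= 1 ->
    Rabs (layer_path v0 v1 xi sigma h) <= K * exp (- (gamma / 2) * xi) /\
    Rabs (layer_path_d1 v0 v1 xi sigma h) <= K * (1 + Rabs sigma) ^ 2 * exp (- (gamma / 2) * xi) /\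
    Rabs (layer_path_d2 v0 v1 xi sigma h) <= K * (1 + Rabs sigma) ^ 2 * exp (- (gamma / 2) * xi).
Proof.
  destruct (layer_decay hb hv) as (K & K0 & HK).
  exists (4 * K). split; [lra|]. intros xi sigma h Hxi Hh.
  destruct (HK xi (h * sigma) Hxi) as (H0 & H1 & H2 & H3 & H4 & H5).
  assert (ep := exp_pos (- (gamma / 2) * xi)). set (E := exp (- (gamma / 2) * xi)) in *.
  assert (KE : 0 <= K * E) by nra.
  assert (sp := Rabs_pos sigma).
  assert (M : forall z w Z, Rabs z <= Z -> Rabs w <= K * E -> Rabs (z * w) <= Z * (K * E)).
  { intros z w Z Hz Hw. rewrite Rabs_mult. apply Rmult_le_compat; auto using Rabs_pos. }
  assert (hh : Rabs h <= 1) by (apply Rabs_le_between; lra).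
  assert (S2 : Rabs (sigma ^ 2) <= Rabs sigma ^ 2) by (right; symmetry; apply RPow_abs).
  assert (P1 : 0 <= Rabs sigma * (K * E)) by (apply Rmult_le_pos; assumption).
  assert (P2 : 0 <= Rabs sigma * (Rabs sigma * (K * E))) by (apply Rmult_le_pos; assumption).
  unfold layer_path, layer_path_d1, layer_path_d2.
  split; [|split].
  - eapply Rle_trans; [apply Rabs_triang|].
    assert (q := M _ _ _ hh H1). lra.
  - eapply Rle_trans; [apply Rabs_triang|].
    eapply Rle_trans; [apply Rplus_le_compat_r, Rabs_triang|].
    assert (q1 := M _ _ _ (Rle_refl _) H2 : Rabs (sigma * _) <= _).
    assert (q2 := M _ _ _ (Rle_refl _) H3 : Rabs (sigma * _) <= _).
    assert (q3 : Rabs (h * (sigma * d_2 v1 (xi, h * sigma))) <= 1 * (Rabs sigma * (K * E)))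
      by (rewrite Rabs_mult; apply Rmult_le_compat; auto using Rabs_pos).
    lra.
  - eapply Rle_trans; [apply Rabs_triang|].
    eapply Rle_trans; [apply Rplus_le_compat_r, Rabs_triang|].
    assert (q1 := M _ _ _ S2 H4).
    assert (q2 : Rabs (2 * sigma * d_2 v1 (xi, h * sigma)) <= 2 * Rabs sigma * (K * E)).
    { apply M; [|exact H3]. rewrite Rabs_mult, (Rabs_pos_eq 2); lra. }
    assert (q3 : Rabs (h * (sigma ^ 2 * d_2 (d_2 v1) (xi, h * sigma))) <= 1 * (Rabs sigma ^ 2 * (K * E)))
      by (rewrite Rabs_mult; apply Rmult_le_compat; auto using Rabs_pos).
    lra.
Qed.

(** Derivative at s = 0 of the equation of v0, whose coefficients depend on s
through the foot s e of the normal. *)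
Lemma layer_tangential_equation {gamma b u0 e r gl v0 v1}
    (hb : reaction_data gamma b u0)
    (hv : boundary_layer gamma b u0 e r gl v0 v1) xi :
  0 < xi ->
  d_1 (d_1 (d_2 v0)) (xi, 0) =
  d_path (reaction b u0) e (d_2 v0 (xi, 0)) (origin, v0 (xi, 0)).
Proof.
  intros Hxi. assert (S := v0_smooth _ _ _ _ _ _ _ _ hv).
  rewrite ddir_commute_twice; auto. rewrite <- Derive_snd.
  apply is_derive_unique.
  eapply is_derive_ext with (f := fun s => reaction b u0 (plus origin (scal s e), v0 (xi, s))).
  - intros s. assert (H := v0_eq _ _ _ _ _ _ _ _ hv xi s Hxi).
    rewrite Derive_n_fst in H. unfold reaction; cbn [fst snd].
    change origin with (@zero (prod_NormedModule R_AbsRing R_NormedModule R_NormedModule)).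
    rewrite plus_zero_l. exact (Rminus_diag_uniq _ _ (eq_trans (Rplus_comm _ _) H)).
  - eapply is_derive_eq.
    + apply (is_derive_path 0 (reaction b u0) origin e (fun s => v0 (xi, s)) 0).
      * exact (tame_reaction gamma b u0 1 hb).
      * apply is_derive_snd. now apply (smooth_ex_ddir half_plane v0 []).
    + f_equal. f_equal. unfold origin. destruct e. unfold_coords. pair_ring.
Qed.

(** * Remainder of a single boundary layer *)

Lemma taylor_bound (f f1 f2 : R -> R) (h K : R) :
  0 <= h -> (forall t, is_derive f t (f1 t)) -> (forall t, is_derive f1 t (f2 t)) ->
  (forall t, 0 <= t <= h -> Rabs (f2 t) <= K) ->
  Rabs (f h - f 0 - h * f1 0) <= K * h ^ 2.
Proof.
  intros Hh D1 D2 HK.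
  replace (f h - f 0 - h * f1 0) with ((f h - h * f1 0) - (f 0 - 0 * f1 0)) by ring.
  replace (K * h ^ 2) with (K * h * Rabs (h - 0)) by (rewrite Rminus_0_r, Rabs_pos_eq by lra; ring).
  apply (mean_value_bound (fun t => f t - t * f1 0) (fun t => f1 t - f1 0)).
  - intros t. apply @is_derive_minus; [apply D1|]. auto_derive; auto; ring.
  - intros t. rewrite Rmin_left, Rmax_right by lra. intros Ht.
    apply Rle_trans with (K * Rabs (t - 0)).
    + apply (mean_value_bound f1 f2); [exact D2|].
      intros r. rewrite Rmin_left, Rmax_right by lra. intros Hr. apply HK; lra.
    + rewrite Rminus_0_r, Rabs_pos_eq by lra. apply Rmult_le_compat_l; [|lra].
      apply Rle_trans with (Rabs (f2 0)); [apply Rabs_pos|apply HK; lra].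
Qed.

(** Each factor 1 + n is absorbed by half of the remaining exponent. *)
Lemma pow_mul_exp_bounded (k : nat) (c : R) : 0 < c ->
  exists K, 0 <= K /\ forall n, 0 <= n -> (1 + n) ^ k * exp (- c * n) <= K.
Proof.
  intros Hc. induction k as [|k IH] in c, Hc |- *.
  - exists 1. split; [lra|]. intros n Hn. simpl. rewrite Rmult_1_l.
    rewrite <- exp_0. destruct (Req_dec n 0) as [->|N].
    + right; f_equal; ring.
    + left. apply exp_increasing. nra.
  - destruct (IH (c / 2) ltac:(lra)) as (K & K0 & HK).
    exists (K * (1 + 2 / c)). assert (q : 0 < 2 / c) by (apply Rdiv_lt_0_compat; lra).
    split; [nra|]. intros n Hn.
    replace ((1 + n) ^ S k * exp (- c * n))
      with (((1 + n) ^ k * exp (- (c / 2) * n)) * ((1 + n) * exp (- (c / 2) * n))).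
    2:{ replace (- c * n) with (- (c / 2) * n + - (c / 2) * n) by field. rewrite exp_plus. simpl. ring. }
    apply Rmult_le_compat; auto.
    + apply Rmult_le_pos; [apply pow_le; lra|left; apply exp_pos].
    + apply Rmult_le_pos; [lra|left; apply exp_pos].
    + assert (ep := exp_pos (- (c / 2) * n)).
      assert (e1 : exp (- (c / 2) * n) <= 1).
      { rewrite <- exp_0. destruct (Req_dec n 0) as [->|N].
        - right; f_equal; ring.
        - left. apply exp_increasing. nra. }
      assert (e2 : n * exp (- (c / 2) * n) <= 2 / c).
      { assert (h := exp_ineq1_le (c / 2 * n)).
        assert (E : exp (c / 2 * n) * exp (- (c / 2) * n) = 1).
        { rewrite <- exp_plus. replace (c / 2 * n + - (c / 2) * n) with 0 by ring. apply exp_0. }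
        assert (n <= 2 / c * exp (c / 2 * n)).
        { replace n with (2 / c * (c / 2 * n)) at 1 by (field; lra).
          apply Rmult_le_compat_l; lra. }
        apply Rle_trans with (2 / c * exp (c / 2 * n) * exp (- (c / 2) * n)).
        - apply Rmult_le_compat_r; lra.
        - rewrite Rmult_assoc, E. lra. }
      lra.
Qed.

(** A single increment is the case of corner_interaction_bound in which the other
two vanish. *)
Lemma single_layer_bound f C : tame 4 f -> (forall x, f (x, 0) = 0) -> 0 <= C ->
  exists K, 0 <= K /\ forall (x y : R * R) a a1 W E, 0 <= E <= 1 -> 1 <= W -> norm y <= W ->
    Rabs a <= C * E -> Rabs a1 <= C * E ->
    Rabs (d2_path f y a1 0 (x, a)) <= K * (W ^ 2 * E).
Proof.
  intros Hf f0 HC.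
  assert (C' : 1 <= 5 * (1 + C) ^ 2) by nra.
  assert (C0 : 0 <= 1 + C) by lra.
  destruct (corner_interaction_bound f (1 + C) Hf f0 C0) as (K & K0 & HK).
  exists (K * (1 + C) ^ 2). split; [apply Rmult_le_pos; nra|].
  intros x y a a1 W E HE HW Hy Ha Ha1.
  assert (CE : C * E <= (1 + C) * E) by nra.
  assert (CW : C * E <= (1 + C) * W * E).
  { apply Rle_trans with ((1 + C) * E); [exact CE|]. apply Rmult_le_compat_r; nra. }
  assert (Z : forall M, 0 <= M -> Rabs 0 <= M) by (intros M; now rewrite Rabs_R0).
  assert (WW : 0 <= (1 + C) * W) by nra.
  assert (Q : Rabs (d2_path f y (0 + 0 + a1) (0 + 0 + 0) (x, 0 + 0 + a)
      - d2_path f y 0 0 (x, 0) - d2_path f y 0 0 (x, 0))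
      <= K * (((1 + C) * W) ^ 2 * (0 * 0 + E))).
  { apply HK; rewrite ?Rabs_R0; try lra; nra. }
  assert (V : d2_path f y 0 0 (x, 0) = 0).
  { assert (V1 : forall e e', snd e = 0 -> snd e' = 0 -> forall x, ddir e (ddir e' f) (x, 0) = 0)
      by (intros; apply ddir_vanishing; auto; intros; apply ddir_vanishing; auto).
    unfold d2_path, d_path. rewrite (V1 e_x1 e_x1), (V1 e_x1 e_x2), (V1 e_x2 e_x1), (V1 e_x2 e_x2)
      by reflexivity.
    ring. }
  rewrite !Rplus_0_l in Q. rewrite V in Q. rewrite Rminus_0_r in Q. rewrite Rminus_0_r in Q.
  eapply Rle_trans; [exact Q|]. right. ring.
Qed.

Definition orthonormal (e r : R * R) : Prop :=
  fst e ^ 2 + snd e ^ 2 = 1 /\ fst r ^ 2 + snd r ^ 2 = 1 /\ dot r e = 0.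

Lemma norm_sqr (x : R * R) : norm x ^ 2 = fst x ^ 2 + snd x ^ 2.
Proof.
  destruct x as [x1 x2]. change (norm (x1, x2)) with (sqrt (Rabs x1 ^ 2 + Rabs x2 ^ 2)).
  rewrite pow2_sqrt by nra. now rewrite <- !Rsqr_pow2, <- !Rsqr_abs.
Qed.

Lemma norm_le (x : R * R) M : 0 <= M -> fst x ^ 2 + snd x ^ 2 <= M ^ 2 -> norm x <= M.
Proof. intros HM H. rewrite <- norm_sqr in H. rewrite <- !Rsqr_pow2 in H. now apply Rsqr_incr_0_var. Qed.

Lemma orthonormal_of_frame (e r : R * R) :
  norm e = 1 -> norm r = 1 -> dot r e = 0 -> orthonormal e r.
Proof.
  intros He Hr Ho. split; [|split]; auto; rewrite <- norm_sqr.
  - rewrite He; ring.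
  - rewrite Hr; ring.
Qed.

(** The rows e, r of an orthogonal matrix are orthonormal, hence so are its columns:
r is e turned by a right angle, up to the sign l. *)
Lemma orthonormal_columns e r : orthonormal e r ->
  fst e ^ 2 + fst r ^ 2 = 1 /\ snd e ^ 2 + snd r ^ 2 = 1 /\ fst e * snd e + fst r * snd r = 0.
Proof.
  intros (He & Hr & Ho). unfold dot in Ho. destruct e as [p q], r as [u v]; cbn [fst snd] in *.
  (* l is the determinant; it is 1 or -1 according to the orientation of (e, r). *)
  set (l := p * v - q * u).
  assert (U : u = - l * q).
  { transitivity (u * (p ^ 2 + q ^ 2) - p * (u * p + v * q)); [rewrite He, Ho; ring|unfold l; ring]. }
  assert (V : v = l * p).
  { transitivity (v * (p ^ 2 + q ^ 2) - q * (u * p + v * q)); [rewrite He, Ho; ring|unfold l; ring]. }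
  assert (L : l ^ 2 = 1).
  { transitivity ((p ^ 2 + q ^ 2) * (u ^ 2 + v ^ 2) - (u * p + v * q) ^ 2);
      [unfold l; ring|rewrite He, Hr, Ho; ring]. }
  clearbody l. subst u v. repeat split.
  - replace (p ^ 2 + (- l * q) ^ 2) with (p ^ 2 + l ^ 2 * q ^ 2) by ring. rewrite L. lra.
  - replace (q ^ 2 + (l * p) ^ 2) with (q ^ 2 + l ^ 2 * p ^ 2) by ring. rewrite L. lra.
  - replace (p * q + - l * q * (l * p)) with (p * q * (1 - l ^ 2)) by ring. rewrite L. ring.
Qed.

Lemma orthonormal_decomposition e r (x : R * R) : orthonormal e r ->
  plus (scal (dot x e) e) (scal (dot x r) r) = x.
Proof.
  intros H. destruct (orthonormal_columns _ _ H) as (H1 & H2 & H3).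
  destruct e as [p q], r as [u v], x as [x1 x2]. unfold dot; cbn [fst snd] in *. unfold_coords.
  apply (f_equal2 pair).
  - transitivity (x1 * (p ^ 2 + u ^ 2) + x2 * (p * q + u * v)); [ring_R|rewrite H1, H3; ring_R].
  - transitivity (x2 * (q ^ 2 + v ^ 2) + x1 * (p * q + u * v)); [ring_R|rewrite H2, H3; ring_R].
Qed.

Lemma Rabs_dot_le e (x : R * R) : fst e ^ 2 + snd e ^ 2 = 1 -> Rabs (dot x e) <= norm x.
Proof.
  intros He. assert (n0 := norm_ge_0 x). apply Rabs_le_between.
  assert (H : dot x e ^ 2 <= norm x ^ 2).
  { rewrite norm_sqr. unfold dot. destruct x as [x1 x2], e as [p q]; cbn [fst snd] in *.
    replace (x1 ^ 2 + x2 ^ 2) with ((x1 * p + x2 * q) ^ 2 + (x1 * q - x2 * p) ^ 2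
        + (x1 ^ 2 + x2 ^ 2) * (1 - (p ^ 2 + q ^ 2))) by ring.
    rewrite He. assert (h := pow2_ge_0 (x1 * q - x2 * p)). lra. }
  split.
  - apply Ropp_le_cancel. rewrite Ropp_involutive. apply Rsqr_incr_0_var; auto.
    rewrite <- Rsqr_neg, !Rsqr_pow2. exact H.
  - apply Rsqr_incr_0_var; auto. rewrite !Rsqr_pow2. exact H.
Qed.

Lemma norm_scal_unit (e : R * R) c : fst e ^ 2 + snd e ^ 2 = 1 -> norm (scal c e) <= Rabs c.
Proof.
  intros He. apply norm_le; [apply Rabs_pos|]. rewrite pow2_abs.
  destruct e as [p q]. unfold_coords. cbn [fst snd] in He.
  right. transitivity (c ^ 2 * (p ^ 2 + q ^ 2)); [ring_R|]. rewrite He. ring_R.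
Qed.

Lemma plus_scal_0 (x y : R * R) : plus x (scal 0 y) = x.
Proof. destruct x, y. unfold_coords. pair_ring. Qed.

(** By the equations of v0 and v1, the subtracted terms are the value and the
derivative at h = 0 of the first one, with eps replaced by h.  The second
derivative contains xi^2, which the decay of the layer absorbs. *)
Lemma layer_normal_residual {gamma b u0 e r gl v0 v1}
    (hb : reaction_data gamma b u0) (hv : boundary_layer gamma b u0 e r gl v0 v1) :
  orthonormal e r ->
  exists K, 0 <= K /\ forall eps xi s : R, 0 <= eps <= 1 -> 0 < xi ->
    Rabs (reaction b u0 (plus (scal s e) (scal eps (scal xi r)), v0 (xi, s) + eps * v1 (xi, s))
      - d_1 (d_1 v0) (xi, s) - eps * d_1 (d_1 v1) (xi, s)) <= K * eps ^ 2.
Proof.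
  intros Her.
  assert (T := fun k => tame_reaction gamma b u0 k hb).
  assert (R0 := fun x => reaction_0 gamma b u0 x hb).
  assert (g0 := gamma_pos _ _ _ hb).
  destruct (layer_decay hb hv) as (K & K0 & HK).
  destruct (single_layer_bound (reaction b u0) (2 * K) (T 4%nat) R0 ltac:(lra)) as (M & M0 & HM).
  destruct (pow_mul_exp_bounded 2 (gamma / 2) ltac:(lra)) as (N & N0 & HN).
  exists (M * N). split; [nra|]. intros eps xi s Heps Hxi.
  destruct (HK xi s Hxi) as (H0 & H1 & _).
  set (a := fun h : R => v0 (xi, s) + h * v1 (xi, s)).
  assert (Da : forall h : R, is_derive a h (v1 (xi, s))) by (intros h; unfold a; auto_derive; auto; ring).
  set (x := scal s e : R * R). set (y := scal xi r : R * R).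
  assert (Tay := taylor_bound (fun h => reaction b u0 (plus x (scal h y), a h))
     (fun h => d_path (reaction b u0) y (v1 (xi, s)) (plus x (scal h y), a h))
     (fun h => d2_path (reaction b u0) y (v1 (xi, s)) 0 (plus x (scal h y), a h))
     eps (M * N) (proj1 Heps)).
  assert (x0 : plus x (scal 0 y) = x) by apply plus_scal_0.
  assert (a0 : a 0 = v0 (xi, s)) by (unfold a; ring).
  cbv beta in Tay. rewrite x0, a0 in Tay.
  assert (E0 : d_1 (d_1 v0) (xi, s) = reaction b u0 (x, v0 (xi, s))).
  { assert (h := v0_eq _ _ _ _ _ _ _ _ hv xi s Hxi). rewrite Derive_n_fst in h.
    unfold reaction; cbn [fst snd]. unfold x. lra. }
  assert (E1 : d_1 (d_1 v1) (xi, s) = d_path (reaction b u0) y (v1 (xi, s)) (x, v0 (xi, s))).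
  { assert (h := v1_eq _ _ _ _ _ _ _ _ hv xi s Hxi). rewrite Derive_n_fst in h.
    rewrite B_t_reaction, grad_B_reaction in h by exact T. fold x in h.
    unfold dot in h; cbn [fst snd] in h. unfold d_path.
    replace (fst y) with (xi * fst r) by (unfold y; now destruct r).
    replace (snd y) with (xi * snd r) by (unfold y; now destruct r). lra. }
  rewrite E0, E1. apply Tay.
  - intros h. apply (is_derive_path 0 (reaction b u0) x y a h); [apply T|apply Da].
  - intros h. apply (is_derive_d_path 0 (reaction b u0) x y a (fun _ => v1 (xi, s)) h 0);
     [apply T|apply Da|apply (is_derive_const (v1 (xi, s)))].
  - intros h Hh.
    assert (e01 : 0 <= exp (- (gamma / 2) * xi) <= 1).
    { split; [left; apply exp_pos|]. rewrite <- exp_0. left; apply exp_increasing. nra. }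
    eapply Rle_trans; [apply (HM _ _ _ _ (1 + xi) (exp (- (gamma / 2) * xi)))|].
    + exact e01.
    + lra.
    + apply Rle_trans with (Rabs xi); [|rewrite Rabs_pos_eq; lra].
      apply norm_scal_unit, Her.
    + unfold a. eapply Rle_trans; [apply Rabs_triang|]. rewrite Rabs_mult, (Rabs_pos_eq h) by lra.
      assert (q := Rabs_pos (v1 (xi, s))). nra.
    + nra.
    + apply Rmult_le_compat_l; [exact M0|]. apply HN; lra.
Qed.

(** * Remainder of the corner layer *)

Lemma dot_pair (x : R * R) a c : dot x (a, c) = fst x * a + snd x * c.
Proof. reflexivity. Qed.

Lemma scal_0_origin (e : R * R) : scal 0 e = origin.
Proof. destruct e. unfold origin. unfold_coords. pair_ring. Qed.

Lemma layer_equation_corner {gamma b u0 e r gl v0 v1}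
    (hb : reaction_data gamma b u0) (hv : boundary_layer gamma b u0 e r gl v0 v1) xi :
  0 < xi -> reaction b u0 (origin, v0 (xi, 0)) = d_1 (d_1 v0) (xi, 0).
Proof.
  intros Hxi. assert (h := v0_eq _ _ _ _ _ _ _ _ hv xi 0 Hxi).
  rewrite Derive_n_fst, scal_0_origin in h. unfold reaction; cbn [fst snd]. lra.
Qed.

(** The decomposition of eta into xi r + sigma e splits the derivative into the right
hand sides of the equation of v1 and of the tangential equation of v0. *)
Lemma layer_first_order_equation_corner {gamma b u0 e r gl v0 v1}
    (hb : reaction_data gamma b u0) (hv : boundary_layer gamma b u0 e r gl v0 v1) (eta : R * R) :
  orthonormal e r -> 0 < dot eta r ->
  d_path (reaction b u0) eta (layer_path_d1 v0 v1 (dot eta r) (dot eta e) 0)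
    (origin, v0 (dot eta r, 0))
  = d_1 (d_1 v1) (dot eta r, 0) + dot eta e * d_1 (d_1 (d_2 v0)) (dot eta r, 0).
Proof.
  intros Her Hxi.
  assert (T := fun k => tame_reaction gamma b u0 k hb).
  assert (h := v1_eq _ _ _ _ _ _ _ _ hv (dot eta r) 0 Hxi).
  rewrite Derive_n_fst, scal_0_origin in h.
  rewrite B_t_reaction, grad_B_reaction in h by exact T.
  rewrite (layer_tangential_equation hb hv) by exact Hxi.
  assert (De := orthonormal_decomposition e r eta Her).
  assert (D1 : fst eta = dot eta e * fst e + dot eta r * fst r)
    by (rewrite <- De at 1; now destruct e, r).
  assert (D2 : snd eta = dot eta e * snd e + dot eta r * snd r)
    by (rewrite <- De at 1; now destruct e, r).
  unfold d_path. rewrite D1, D2. unfold layer_path_d1. rewrite Rmult_0_l.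
  rewrite dot_pair in h. lra.
Qed.

Lemma sector_scal es em c (x : R * R) : 0 < c -> sector es em x -> sector es em (scal c x).
Proof.
  intros Hc (a & a' & Ha & Ha' & ->). exists (c * a), (c * a').
  split; [now apply Rmult_lt_0_compat|split; [now apply Rmult_lt_0_compat|]].
  destruct es, em. unfold_coords. pair_ring.
Qed.

Lemma dot_plus_scal (e1 e2 r : R * R) (a c : R) :
  dot (plus (scal a e1) (scal c e2)) r = a * dot e1 r + c * dot e2 r.
Proof. destruct e1, e2, r. unfold dot; unfold_coords. ring_R. Qed.

Lemma dot_sym (x y : R * R) : dot x y = dot y x.
Proof. unfold dot; ring. Qed.

Lemma dot_scal (x r : R * R) c : dot (scal c x) r = c * dot x r.
Proof. destruct x, r. unfold dot; unfold_coords. ring_R. Qed.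

Lemma frame_transversal omega es er em erm : sector_frame omega es er em erm ->
  0 < dot em er /\ 0 < dot es erm.
Proof.
  intros H.
  assert (S : sector es em (plus (scal 1 es) (scal 1 em))).
  { exists 1, 1. repeat split; lra. }
  assert (h1 := frame_er_inward _ _ _ _ _ H _ S). assert (h2 := frame_erm_inward _ _ _ _ _ H _ S).
  rewrite dot_plus_scal in h1, h2.
  rewrite (dot_sym es er), (frame_er_orth _ _ _ _ _ H) in h1.
  rewrite (dot_sym em erm), (frame_erm_orth _ _ _ _ _ H) in h2. lra.
Qed.

(** For x = a es + c em the two distances are c (em . er) and a (es . erm). *)
Lemma sector_distance omega es er em erm : sector_frame omega es er em erm ->
  exists kappa, 0 < kappa /\ forall x, sector es em x ->
    0 < dot x er /\ 0 < dot x erm /\ kappa * norm x <= dot x er + dot x erm.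
Proof.
  intros H. destruct (frame_transversal _ _ _ _ _ H) as [k1 k2].
  set (k := Rmin (dot em er) (dot es erm)).
  assert (k0 : 0 < k) by now apply Rmin_glb_lt.
  exists k. split; [exact k0|]. intros x Hx.
  split; [exact (frame_er_inward _ _ _ _ _ H x Hx)|].
  split; [exact (frame_erm_inward _ _ _ _ _ H x Hx)|].
  destruct Hx as (a & c & Ha & Hc & ->).
  rewrite !dot_plus_scal, (dot_sym es er), (dot_sym em erm), (frame_er_orth _ _ _ _ _ H),
    (frame_erm_orth _ _ _ _ _ H).
  destruct (orthonormal_of_frame _ _ (frame_es _ _ _ _ _ H) (frame_er _ _ _ _ _ H)
     (frame_er_orth _ _ _ _ _ H)) as (N1 & _).
  destruct (orthonormal_of_frame _ _ (frame_em _ _ _ _ _ H) (frame_erm _ _ _ _ _ H)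
     (frame_erm_orth _ _ _ _ _ H)) as (N2 & _).
  assert (n1 := norm_scal_unit es a N1). assert (n2 := norm_scal_unit em c N2).
  rewrite (Rabs_pos_eq a) in n1 by lra. rewrite (Rabs_pos_eq c) in n2 by lra.
  assert (m1 : k <= dot em er) by apply Rmin_l. assert (m2 : k <= dot es erm) by apply Rmin_r.
  apply Rle_trans with (k * (a + c)); [|nra].
  apply Rmult_le_compat_l; [lra|].
  eapply Rle_trans; [apply (norm_triangle (scal a es) (scal c em))|].
  exact (Rplus_le_compat _ _ _ _ n1 n2).
Qed.

(** The first three terms are phi(eps); the equations of z0, z1 and of the boundary
layers at the corner identify the other ones with phi(0) + eps phi'(0). *)
Lemma corner_residual {omega gamma b u0 g es er em erm gl glm v0 v1 v0m v1m z0 z1}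
    (hf : sector_frame omega es er em erm)
    (hb : reaction_data gamma b u0)
    (hv : boundary_layer gamma b u0 es er gl v0 v1)
    (hvm : boundary_layer gamma b u0 em erm glm v0m v1m)
    (hz : corner_layer b u0 g es er em erm gl glm v0 v1 v0m v1m z0 z1) :
  exists K, 0 <= K /\ forall (eps : R) (eta : R * R), 0 <= eps <= 1 -> sector es em eta ->
    let p := layer_path v0 v1 (dot eta er) (dot eta es) eps in
    let pm := layer_path v0m v1m (dot eta erm) (dot eta em) eps in
    let q := q0 er erm v0 v0m z0 eta + eps * q1 es er em erm v0 v1 v0m v1m z1 eta in
    let x : R * R := plus origin (scal eps eta) in
    Rabs (reaction b u0 (x, p + pm + q) - reaction b u0 (x, p) - reaction b u0 (x, pm)
      - (laplacian z0 eta - d_1 (d_1 v0) (dot eta er, 0) - d_1 (d_1 v0m) (dot eta erm, 0))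
      - eps * (laplacian z1 eta
         - (d_1 (d_1 v1) (dot eta er, 0) + dot eta es * d_1 (d_1 (d_2 v0)) (dot eta er, 0))
         - (d_1 (d_1 v1m) (dot eta erm, 0) + dot eta em * d_1 (d_1 (d_2 v0m)) (dot eta erm, 0))))
    <= K * eps ^ 2.
Proof.
  assert (T := fun k => tame_reaction gamma b u0 k hb).
  assert (R0 := fun x => reaction_0 gamma b u0 x hb).
  assert (g0 := gamma_pos _ _ _ hb).
  assert (O1 := orthonormal_of_frame _ _ (frame_es _ _ _ _ _ hf) (frame_er _ _ _ _ _ hf)
     (frame_er_orth _ _ _ _ _ hf)).
  assert (O2 := orthonormal_of_frame _ _ (frame_em _ _ _ _ _ hf) (frame_erm _ _ _ _ _ hf)
     (frame_erm_orth _ _ _ _ _ hf)).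
  destruct (layer_path_bounds hb hv) as (K1 & K1p & H1).
  destruct (layer_path_bounds hb hvm) as (K2 & K2p & H2).
  destruct (q_decay _ _ _ _ _ _ _ _ _ _ _ _ _ _ _ hz) as (C1 & c1 & C1p & c1p & Hq).
  destruct (sector_distance _ _ _ _ _ hf) as (kappa & kp & Hk).
  set (M := 1 + K1 + K2 + C1).
  destruct (corner_interaction_bound (reaction b u0) M (T 4%nat) R0 ltac:(unfold M; lra))
    as (L & L0 & HL).
  destruct (pow_mul_exp_bounded 4 (gamma / 2 * kappa)) as (N1 & N1p & HN1);
    [apply Rmult_lt_0_compat; lra|].
  destruct (pow_mul_exp_bounded 4 c1 c1p) as (N2 & N2p & HN2).
  exists (L * (M ^ 2 * (N1 + N2))).
  split; [apply Rmult_le_pos; [|apply Rmult_le_pos]; try lra; apply pow2_ge_0|].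
  intros eps eta Heps Heta. cbv zeta.
  destruct (Hk eta Heta) as (Hxi & Hxim & Hdist). specialize (Hq eta Heta).
  set (xi := dot eta er) in *. set (xim := dot eta erm) in *.
  set (sg := dot eta es). set (sgm := dot eta em).
  set (Q0 := q0 er erm v0 v0m z0 eta) in *.
  set (Q1 := q1 es er em erm v0 v1 v0m v1m z1 eta) in *.
  set (A := layer_path v0 v1 xi sg). set (A1 := layer_path_d1 v0 v1 xi sg).
  set (A2 := layer_path_d2 v0 v1 xi sg).
  set (Am := layer_path v0m v1m xim sgm). set (Am1 := layer_path_d1 v0m v1m xim sgm).
  set (Am2 := layer_path_d2 v0m v1m xim sgm).
  set (q := fun h => Q0 + h * Q1).
  assert (DA : forall h, is_derive A h (A1 h)).
  { intros h. apply is_derive_layer_path;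
      [apply (v0_smooth _ _ _ _ _ _ _ _ hv)
      |apply (v1_smooth _ _ _ _ _ _ _ _ hv)|exact Hxi]. }
  assert (DA1 : forall h, is_derive A1 h (A2 h)).
  { intros h. apply is_derive_layer_path_d1;
      [apply (v0_smooth _ _ _ _ _ _ _ _ hv)
      |apply (v1_smooth _ _ _ _ _ _ _ _ hv)|exact Hxi]. }
  assert (DB : forall h, is_derive Am h (Am1 h)).
  { intros h. apply is_derive_layer_path;
      [apply (v0_smooth _ _ _ _ _ _ _ _ hvm)
      |apply (v1_smooth _ _ _ _ _ _ _ _ hvm)|exact Hxim]. }
  assert (DB1 : forall h, is_derive Am1 h (Am2 h)).
  { intros h. apply is_derive_layer_path_d1;
      [apply (v0_smooth _ _ _ _ _ _ _ _ hvm)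
      |apply (v1_smooth _ _ _ _ _ _ _ _ hvm)|exact Hxim]. }
  assert (Dq : forall h : R, is_derive q h Q1) by (intros h; unfold q; auto_derive; auto; ring).
  set (S := fun h => A h + Am h + q h). set (S1 := fun h => A1 h + Am1 h + Q1).
  set (S2 := fun h => A2 h + Am2 h + 0).
  assert (DS : forall h, is_derive S h (S1 h)).
  { intros h. apply @is_derive_plus; [apply @is_derive_plus|]; auto. }
  assert (DS1 : forall h, is_derive S1 h (S2 h)).
  { intros h. apply @is_derive_plus; [apply @is_derive_plus|]; auto. apply (is_derive_const Q1). }
  set (f := reaction b u0) in *.
  set (X := fun h : R => plus origin (scal h eta) : R * R).
  assert (X0 : X 0 = origin) by apply plus_scal_0.
  assert (Tay := taylor_bound
     (fun h => f (X h, S h) - f (X h, A h)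
               - f (X h, Am h))
     (fun h => d_path f eta (S1 h) (X h, S h)
               - d_path f eta (A1 h) (X h, A h)
               - d_path f eta (Am1 h) (X h, Am h))
     (fun h => d2_path f eta (S1 h) (S2 h) (X h, S h)
               - d2_path f eta (A1 h) (A2 h) (X h, A h)
               - d2_path f eta (Am1 h) (Am2 h) (X h, Am h))
     eps (L * (M ^ 2 * (N1 + N2))) (proj1 Heps)).
  cbv beta in Tay. rewrite X0 in Tay.
  assert (A0 : A 0 = v0 (xi, 0)) by (unfold A, layer_path; rewrite Rmult_0_l; ring).
  assert (B0 : Am 0 = v0m (xim, 0)) by (unfold Am, layer_path; rewrite Rmult_0_l; ring).
  assert (S0 : S 0 = z0 eta).
  { unfold S. rewrite A0, B0. unfold q, Q0, q0. fold xi xim. ring. }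
  assert (S10 : S1 0 = z1 eta).
  { unfold S1, A1, Am1, layer_path_d1, Q1, q1, layer1. fold xi xim sg sgm.
    rewrite !Derive_snd, !Rmult_0_l. ring. }
  rewrite A0, B0, S0, S10 in Tay.
  assert (Z0 : f (origin, z0 eta) = laplacian z0 eta).
  { assert (h := z0_eq _ _ _ _ _ _ _ _ _ _ _ _ _ _ _ hz eta Heta).
    unfold f, reaction; cbn [fst snd]. lra. }
  assert (Z1 : d_path f eta (z1 eta) (origin, z0 eta) = laplacian z1 eta).
  { assert (h := z1_eq _ _ _ _ _ _ _ _ _ _ _ _ _ _ _ hz eta Heta).
    rewrite B_t_reaction, grad_B_reaction in h by exact T. fold f in h.
    rewrite dot_pair in h. unfold d_path. lra. }
  assert (V0 := layer_equation_corner hb hv xi Hxi).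
  assert (V0m := layer_equation_corner hb hvm xim Hxim).
  assert (V1 := layer_first_order_equation_corner hb hv eta O1 Hxi).
  assert (V1m := layer_first_order_equation_corner hb hvm eta O2 Hxim).
  fold f xi sg in V0, V1. fold f xim sgm in V0m, V1m.
  change (layer_path_d1 v0 v1 xi sg 0) with (A1 0) in V1.
  change (layer_path_d1 v0m v1m xim sgm 0) with (Am1 0) in V1m.
  rewrite Z0, Z1, V0, V0m, V1, V1m in Tay.
  apply Tay; clear Tay.
  - intros h. apply @is_derive_minus; [apply @is_derive_minus|];
      apply (is_derive_path 0 f origin eta); auto.
  - intros h. apply @is_derive_minus; [apply @is_derive_minus|];
      apply (is_derive_d_path 0 f origin eta); auto.
  - intros h Hh.
    assert (Hh1 : 0 <= h <= 1) by lra.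
    destruct (H1 xi sg h Hxi Hh1) as (a0 & a1 & a2).
    destruct (H2 xim sgm h Hxim Hh1) as (b0 & b1 & b2).
    fold A in a0. fold A1 in a1. fold A2 in a2. fold Am in b0. fold Am1 in b1. fold Am2 in b2.
    set (n := norm eta) in *. assert (n0 : 0 <= n) by apply norm_ge_0.
    assert (s1 : Rabs sg <= n) by (apply Rabs_dot_le, O1).
    assert (s2 : Rabs sgm <= n) by (apply Rabs_dot_le, O2).
    assert (sp1 := Rabs_pos sg). assert (sp2 := Rabs_pos sgm).
    assert (ex : forall t, 0 <= t -> 0 <= exp (- (gamma / 2) * t) <= 1).
    { intros t Ht. split; [left; apply exp_pos|]. rewrite <- exp_0.
      destruct (Req_dec t 0) as [->|Nt]; [right; f_equal; ring|].
      left; apply exp_increasing. nra. }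
    assert (e1 := ex xi ltac:(lra)). assert (e2 := ex xim ltac:(lra)).
    assert (e3 : 0 <= exp (- c1 * n) <= 1).
    { split; [left; apply exp_pos|]. rewrite <- exp_0.
      destruct (Req_dec n 0) as [->|Nt]; [right; f_equal; ring|].
      left; apply exp_increasing. nra. }
    assert (E12 : exp (- (gamma / 2) * xi) * exp (- (gamma / 2) * xim)
         <= exp (- (gamma / 2 * kappa) * n)).
    { rewrite <- exp_plus. assert (d : - (gamma / 2) * xi + - (gamma / 2) * xim
        <= - (gamma / 2 * kappa) * n) by nra.
      destruct d as [d|d]; [left; now apply exp_increasing|right; now f_equal]. }
    set (E1 := exp (- (gamma / 2) * xi)) in *. set (E2 := exp (- (gamma / 2) * xim)) in *.
    set (E3 := exp (- c1 * n)) in *.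
    assert (W1 : 1 <= (1 + n) ^ 2) by nra.
    set (W := M * (1 + n) ^ 2).
    assert (M1 : 1 <= M) by (unfold M; lra).
    assert (MW : M <= W) by (unfold W; nra).
    assert (pw : forall K s E, 0 <= K <= M -> 0 <= s <= n -> 0 <= E ->
        K * (1 + s) ^ 2 * E <= W * E).
    { intros K s E HK Hs HE. apply Rmult_le_compat_r; [exact HE|]. unfold W.
      apply Rmult_le_compat; try lra; [apply pow2_ge_0|]. apply pow_incr; lra. }
    assert (qp0 := Rabs_pos Q0). assert (qp1 := Rabs_pos Q1).
    assert (ME3 : C1 * E3 <= M * E3) by (apply Rmult_le_compat_r; unfold M; lra).
    assert (WE3 : M * E3 <= W * E3) by (apply Rmult_le_compat_r; lra).
    eapply Rle_trans.
    + apply (HL _ eta (A h) (Am h) (q h) (A1 h) (Am1 h) Q1 (A2 h) (Am2 h) 0 W E1 E2 E3); auto.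
      * lra.
      * change (n <= W). unfold W. nra.
      * eapply Rle_trans; [exact a0|]. apply Rmult_le_compat_r; unfold M; lra.
      * eapply Rle_trans; [exact b0|]. apply Rmult_le_compat_r; unfold M; lra.
      * unfold q. eapply Rle_trans; [apply Rabs_triang|].
        rewrite Rabs_mult, (Rabs_pos_eq h) by lra. nra.
      * eapply Rle_trans; [exact a1|]. apply pw; unfold M; lra.
      * eapply Rle_trans; [exact b1|]. apply pw; unfold M; lra.
      * lra.
      * eapply Rle_trans; [exact a2|]. apply pw; unfold M; lra.
      * eapply Rle_trans; [exact b2|]. apply pw; unfold M; lra.
      * rewrite Rabs_R0. nra.
    + apply Rmult_le_compat_l; [exact L0|].
      replace (W ^ 2 * (E1 * E2 + E3))
        with (M ^ 2 * ((1 + n) ^ 4 * (E1 * E2) + (1 + n) ^ 4 * E3)) by (unfold W; ring).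
      apply Rmult_le_compat_l; [apply pow2_ge_0|]. apply Rplus_le_compat.
      * apply Rle_trans with ((1 + n) ^ 4 * exp (- (gamma / 2 * kappa) * n)).
        -- apply Rmult_le_compat_l; [apply pow_le; lra|exact E12].
        -- now apply HN1.
      * now apply HN2.
Qed.

(** Along a ray that leaves the side, xi grows like |sigma|, so that the decay in xi
absorbs the factor sigma^2 of the second derivative. *)
Lemma layer_path_taylor_along_ray {gamma b u0 e r gl v0 v1}
    (hb : reaction_data gamma b u0) (hv : boundary_layer gamma b u0 e r gl v0 v1) (d : R * R) :
  orthonormal e r -> 0 < dot d r ->
  exists K, forall (eps rho : R), 0 <= eps <= 1 -> 0 < rho ->
    Rabs (layer_path v0 v1 (rho * dot d r) (rho * dot d e) eps
      - v0 (rho * dot d r, 0)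
      - eps * (v1 (rho * dot d r, 0) + rho * dot d e * d_2 v0 (rho * dot d r, 0)))
    <= K * eps ^ 2.
Proof.
  intros Her Hd.
  assert (g0 := gamma_pos _ _ _ hb).
  destruct (layer_path_bounds hb hv) as (K & Kp & H).
  set (m := 1 + Rabs (dot d e)).
  assert (m1 : 1 <= m) by (unfold m; assert (h := Rabs_pos (dot d e)); lra).
  destruct (pow_mul_exp_bounded 2 (gamma / 2 * dot d r)) as (N & Np & HN);
    [apply Rmult_lt_0_compat; lra|].
  exists (K * (m ^ 2 * N)). intros eps rho Heps Hrho.
  assert (Hxi : 0 < rho * dot d r) by now apply Rmult_lt_0_compat.
  assert (S0 := v0_smooth _ _ _ _ _ _ _ _ hv). assert (S1 := v1_smooth _ _ _ _ _ _ _ _ hv).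
  set (xi := rho * dot d r) in *. set (sg := rho * dot d e).
  assert (Tay := taylor_bound (layer_path v0 v1 xi sg) (layer_path_d1 v0 v1 xi sg)
    (layer_path_d2 v0 v1 xi sg) eps (K * (m ^ 2 * N)) (proj1 Heps)
    (fun h => is_derive_layer_path v0 v1 xi sg h S0 S1 Hxi)
    (fun h => is_derive_layer_path_d1 v0 v1 xi sg h S0 S1 Hxi)).
  replace (layer_path v0 v1 xi sg 0) with (v0 (xi, 0)) in Tay
    by (unfold layer_path; rewrite Rmult_0_l; ring).
  replace (layer_path_d1 v0 v1 xi sg 0) with (v1 (xi, 0) + sg * d_2 v0 (xi, 0)) in Tay
    by (unfold layer_path_d1; rewrite Rmult_0_l; ring).
  apply Tay. intros t Ht.
  destruct (H xi sg t Hxi ltac:(lra)) as (_ & _ & h2).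
  eapply Rle_trans; [exact h2|]. rewrite Rmult_assoc. apply Rmult_le_compat_l; [exact Kp|].
  replace (- (gamma / 2) * xi) with (- (gamma / 2 * dot d r) * rho) by (unfold xi; ring).
  apply Rle_trans with (m ^ 2 * ((1 + rho) ^ 2 * exp (- (gamma / 2 * dot d r) * rho))).
  - rewrite <- Rmult_assoc. apply Rmult_le_compat_r; [left; apply exp_pos|].
    rewrite <- Rpow_mult_distr. apply pow_incr. unfold sg.
    rewrite Rabs_mult, (Rabs_pos_eq rho) by lra.
    assert (h := Rabs_pos (dot d e)). unfold m. split; nra.
  - apply Rmult_le_compat_l; [apply pow2_ge_0|]. apply HN. lra.
Qed.

(** * Laplacians of the layers *)

(** Derive is a total function; keeping existence together with the value is what
allows second derivatives to be added. *)
Definition second_derivative_at_0 (f : R -> R) (l : R) : Prop :=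
  exists f1 : R -> R, locally 0 (fun t => is_derive f t (f1 t)) /\ is_derive f1 0 l.

Definition has_laplacian (f : R * R -> R) (x : R * R) (L : R) : Prop :=
  exists l1 l2, second_derivative_at_0 (fun t => f (plus x (scal t e_1))) l1 /\
    second_derivative_at_0 (fun t => f (plus x (scal t e_2))) l2 /\ L = l1 + l2.

Lemma second_derivative_plus f g l m :
  second_derivative_at_0 f l -> second_derivative_at_0 g m ->
  second_derivative_at_0 (fun t => f t + g t) (l + m).
Proof.
  intros (f1 & F1 & F2) (g1 & G1 & G2). exists (fun t => f1 t + g1 t). split.
  - generalize (filter_and _ _ F1 G1). apply filter_imp. intros t [H1 H2].
    now apply @is_derive_plus.
  - now apply @is_derive_plus.
Qed.

Lemma second_derivative_scal f l c :
  second_derivative_at_0 f l -> second_derivative_at_0 (fun t => c * f t) (c * l).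
Proof.
  intros (f1 & F1 & F2). exists (fun t => c * f1 t). split.
  - generalize F1. apply filter_imp. intros t H. now apply is_derive_scal.
  - now apply is_derive_scal.
Qed.

Lemma second_derivative_ext f g l :
  (forall t, f t = g t) -> second_derivative_at_0 f l -> second_derivative_at_0 g l.
Proof.
  intros E (f1 & F1 & F2). exists f1. split; [|exact F2].
  generalize F1. apply filter_imp. intros t H. now apply (is_derive_ext f).
Qed.

Lemma second_derivative_linear_mult f f1 l a c :
  locally 0 (fun t => is_derive f t (f1 t)) -> is_derive f1 0 l ->
  second_derivative_at_0 (fun t => (a + t * c) * f t) (a * l + 2 * c * f1 0).
Proof.
  intros F1 F2. exists (fun t => c * f t + (a + t * c) * f1 t).
  assert (D : forall t : R, is_derive (fun t => a + t * c) t c)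
    by (intros t; auto_derive; auto; ring).
  split.
  - generalize F1. apply filter_imp. intros t H. eapply is_derive_eq.
    + apply (is_derive_mult (fun t => a + t * c) f); [apply D|exact H|exact Rmult_comm].
    + unfold plus, mult; simpl. ring.
  - apply locally_singleton in F1. eapply is_derive_eq.
    + apply @is_derive_plus; [apply is_derive_scal, F1|].
      apply (is_derive_mult (fun t => a + t * c) f1); [apply D|exact F2|exact Rmult_comm].
    + unfold plus, mult; simpl. ring.
Qed.

Lemma second_derivative_line {V : NormedModule R_AbsRing} (f : V -> R) x e l :
  second_derivative_at_0 (fun t => f (plus x (scal t e))) l -> ddir e (ddir e f) x = l.
Proof.
  intros (f1 & F1 & F2). unfold ddir at 1.
  rewrite (Derive_ext_loc _ f1); [now apply is_derive_unique|].
  generalize F1. apply filter_imp. intros t H. apply is_derive_unique in H.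
  rewrite <- H, Derive_shift. apply Derive_ext. intros h. f_equal.
  rewrite <- plus_assoc. f_equal. symmetry. exact (scal_distr_r t h e).
Qed.

Lemma has_laplacian_unique f x L : has_laplacian f x L -> laplacian f x = L.
Proof.
  intros (l1 & l2 & H1 & H2 & ->). rewrite laplacian_ddir.
  f_equal; now apply (second_derivative_line (V := plane)).
Qed.

Lemma has_laplacian_plus f g x L M : has_laplacian f x L -> has_laplacian g x M ->
  has_laplacian (fun y => f y + g y) x (L + M).
Proof.
  intros (l1 & l2 & H1 & H2 & ->) (m1 & m2 & G1 & G2 & ->).
  exists (l1 + m1), (l2 + m2). split; [|split]; try ring; now apply second_derivative_plus.
Qed.

Lemma has_laplacian_scal f x L c : has_laplacian f x L ->
  has_laplacian (fun y => c * f y) x (c * L).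
Proof.
  intros (l1 & l2 & H1 & H2 & ->).
  exists (c * l1), (c * l2). split; [|split]; try ring; now apply second_derivative_scal.
Qed.

Lemma has_laplacian_minus f g x L M : has_laplacian f x L -> has_laplacian g x M ->
  has_laplacian (fun y => f y - g y) x (L - M).
Proof.
  intros Hf Hg. destruct (has_laplacian_plus _ _ _ _ _ Hf (has_laplacian_scal _ _ _ (-1) Hg))
    as (l1 & l2 & H1 & H2 & E).
  exists l1, l2. split; [|split]; [..|lra];
   (eapply second_derivative_ext; [|eassumption]); intros t; simpl; ring.
Qed.

Lemma locally_0_affine_pos (a c : R) : 0 < a -> locally 0 (fun t : R => 0 < a + t * c).
Proof.
  intros Ha.
  assert (C : continuous (fun t : R => a + t * c) 0).
  { apply (ex_derive_continuous (fun t : R => a + t * c)). auto_derive; auto. }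
  apply C. rewrite Rmult_0_l, Rplus_0_r. exists (mkposreal a Ha). intros y Hy.
  change (Rabs (y - a) < a) in Hy. apply Rabs_lt_between in Hy. lra.
Qed.

Lemma half_plane_line_derivative (f : R * R -> R) (P Q : R * R) (t : R) :
  smooth_on half_plane f -> 0 < fst P + t * fst Q ->
  is_derive (fun h => f (plus P (scal h Q))) t
    (fst Q * d_1 f (plus P (scal t Q)) + snd Q * d_2 f (plus P (scal t Q))).
Proof.
  intros S Ht. set (p := plus P (scal t Q) : R * R).
  assert (Hp : 0 < fst p) by (unfold p; destruct P, Q; exact Ht).
  apply is_derive_shift.
  eapply is_derive_ext; [|apply (is_derive_combination
     (V := plane) f p e_1 e_2 (fst Q) (snd Q))].
  - intros h. apply (f_equal f). unfold p. destruct P, Q. unfold_coords. pair_ring.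
  - destruct (half_plane_open p Hp) as [d Hd]. exists d. intros y Hy.
    apply (smooth_ex_ddir half_plane f []); [exact S|]. now apply Hd.
  - now apply (smooth_continuous half_plane f [e_1]).
  - now apply (smooth_ex_ddir half_plane f []).
Qed.

Lemma half_plane_line_second_derivative (f : R * R -> R) (P Q : R * R) :
  smooth_on half_plane f -> 0 < fst P ->
  is_derive (fun t => fst Q * d_1 f (plus P (scal t Q)) + snd Q * d_2 f (plus P (scal t Q))) 0
    (fst Q ^ 2 * d_1 (d_1 f) P + fst Q * snd Q * (d_2 (d_1 f) P + d_1 (d_2 f) P)
     + snd Q ^ 2 * d_2 (d_2 f) P).
Proof.
  intros S HP. assert (HP' : 0 < fst P + 0 * fst Q) by lra.
  eapply is_derive_eq.
  - apply @is_derive_plus; apply is_derive_scal, half_plane_line_derivative;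
      auto; now apply smooth_ddir.
  - rewrite !plus_scal_0. unfold plus; simpl. ring.
Qed.

Lemma half_plane_line (f : R * R -> R) (P Q : R * R) :
  smooth_on half_plane f -> 0 < fst P ->
  second_derivative_at_0 (fun t => f (plus P (scal t Q)))
    (fst Q ^ 2 * d_1 (d_1 f) P + fst Q * snd Q * (d_2 (d_1 f) P + d_1 (d_2 f) P)
     + snd Q ^ 2 * d_2 (d_2 f) P).
Proof.
  intros S HP. eexists. split; [|now apply half_plane_line_second_derivative].
  generalize (locally_0_affine_pos (fst P) (fst Q) HP). apply filter_imp.
  intros t Ht. now apply half_plane_line_derivative.
Qed.

(** Rotation invariance of the Laplacian: summing over the two coordinate directions
turns the coefficients of the pure second derivatives into |r|^2 / eps^2 and
|e|^2, and that of the mixed ones into r . e = 0. *)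
Lemma has_laplacian_layer (f : R * R -> R) (e r : R * R) (eps : R) (x : R * R) :
  orthonormal e r -> 0 < eps ->
  smooth_on half_plane f -> 0 < dot x r ->
  has_laplacian (fun y => f (dot y r / eps, dot y e)) x
    (d_1 (d_1 f) (dot x r / eps, dot x e) / eps ^ 2 + d_2 (d_2 f) (dot x r / eps, dot x e)).
Proof.
  intros (He & Hr & Ho) Heps S Hx.
  assert (Hp : 0 < dot x r / eps) by now apply Rdiv_lt_0_compat.
  destruct e as [p q], r as [u v], x as [x1 x2]. cbn [fst snd] in He, Hr.
  unfold dot in Ho; cbn [fst snd] in Ho.
  set (P := (dot (x1, x2) (u, v) / eps, dot (x1, x2) (p, q))) in *.
  eexists _, _. split; [|split].
  - eapply second_derivative_ext; [|apply (half_plane_line f P (u / eps, p) S Hp)].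
    intros t. apply (f_equal f). unfold P, dot. unfold_coords. apply (f_equal2 pair); [|ring_R].
    field_R.
  - eapply second_derivative_ext; [|apply (half_plane_line f P (v / eps, q) S Hp)].
    intros t. apply (f_equal f). unfold P, dot. unfold_coords. apply (f_equal2 pair); [|ring_R].
    field_R.
  - cbn [fst snd].
    set (A := d_1 (d_1 f) P). set (Bc := d_2 (d_1 f) P + d_1 (d_2 f) P). set (D := d_2 (d_2 f) P).
    transitivity ((u ^ 2 + v ^ 2) * A / eps ^ 2 + (u * p + v * q) * Bc / eps + (p ^ 2 + q ^ 2) * D).
    + rewrite He, Hr, Ho. field. lra.
    + field. lra.
Qed.

Lemma has_laplacian_layer_corner (f : R * R -> R) (e r : R * R) (eps : R) (x : R * R) :
  orthonormal e r -> 0 < eps ->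
  smooth_on half_plane f -> 0 < dot x r ->
  has_laplacian (fun y => f (dot (scal (/ eps) y) r, 0)) x
    (d_1 (d_1 f) (dot (scal (/ eps) x) r, 0) / eps ^ 2).
Proof.
  intros (He & Hr & Ho) Heps S Hx.
  assert (Hp : 0 < dot (scal (/ eps) x) r).
  { rewrite dot_scal. apply Rmult_lt_0_compat; [now apply Rinv_0_lt_compat|exact Hx]. }
  set (P := (dot (scal (/ eps) x) r, 0)) in *.
  destruct r as [u v], x as [x1 x2]. cbn [fst snd] in Hr.
  eexists _, _. split; [|split].
  - eapply second_derivative_ext; [|apply (half_plane_line f P (u / eps, 0) S Hp)].
    intros t. apply (f_equal f). unfold P. rewrite !dot_scal. unfold dot. unfold_coords.
    apply (f_equal2 pair); [|ring_R].
    field_R.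
  - eapply second_derivative_ext; [|apply (half_plane_line f P (v / eps, 0) S Hp)].
    intros t. apply (f_equal f). unfold P. rewrite !dot_scal. unfold dot. unfold_coords.
    apply (f_equal2 pair); [|ring_R].
    field_R.
  - cbn [fst snd].
    transitivity ((u ^ 2 + v ^ 2) * d_1 (d_1 f) P / eps ^ 2).
    + rewrite Hr. field. lra.
    + field. lra.
Qed.

(** The product rule adds a first derivative of f to the second one, with
coefficient 2 (r . e) / eps^2 = 0. *)
Lemma has_laplacian_layer_corner_tangential (f : R * R -> R) (e r : R * R) (eps : R) (x : R * R) :
  orthonormal e r -> 0 < eps ->
  smooth_on half_plane f -> 0 < dot x r ->
  has_laplacian (fun y => dot (scal (/ eps) y) e * f (dot (scal (/ eps) y) r, 0)) x
    (dot (scal (/ eps) x) e * d_1 (d_1 f) (dot (scal (/ eps) x) r, 0) / eps ^ 2).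
Proof.
  intros (He & Hr & Ho) Heps S Hx.
  assert (Hp : 0 < dot (scal (/ eps) x) r).
  { rewrite dot_scal. apply Rmult_lt_0_compat; [now apply Rinv_0_lt_compat|exact Hx]. }
  set (P := (dot (scal (/ eps) x) r, 0)) in *. set (sg := dot (scal (/ eps) x) e).
  assert (L : forall Q : R * R, locally 0 (fun t => is_derive (fun h => f (plus P (scal h Q))) t
     (fst Q * d_1 f (plus P (scal t Q)) + snd Q * d_2 f (plus P (scal t Q))))).
  { intros Q. generalize (locally_0_affine_pos (fst P) (fst Q) Hp). apply filter_imp.
    intros t Ht. now apply half_plane_line_derivative. }
  destruct e as [p q], r as [u v], x as [x1 x2]. cbn [fst snd] in He, Hr.
  unfold dot in Ho; cbn [fst snd] in Ho.
  eexists _, _. split; [|split].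
  - eapply second_derivative_ext; [|apply (second_derivative_linear_mult _ _ _ sg (p / eps)
      (L (u / eps, 0)) (half_plane_line_second_derivative f P (u / eps, 0) S Hp))].
    intros t. unfold P, sg. rewrite !dot_scal.
    apply (f_equal2 Rmult); [|apply (f_equal f)]; unfold dot; unfold_coords.
    + field; lra.
    + apply (f_equal2 pair); [|ring_R].
      field_R.
  - eapply second_derivative_ext; [|apply (second_derivative_linear_mult _ _ _ sg (q / eps)
      (L (v / eps, 0)) (half_plane_line_second_derivative f P (v / eps, 0) S Hp))].
    intros t. unfold P, sg. rewrite !dot_scal.
    apply (f_equal2 Rmult); [|apply (f_equal f)]; unfold dot; unfold_coords.
    + field; lra.
    + apply (f_equal2 pair); [|ring_R].
      field_R.
  - cbn [fst snd]. rewrite !plus_scal_0.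
    set (A := d_1 (d_1 f) P). set (G := d_1 f P).
    transitivity (sg * ((u ^ 2 + v ^ 2) * A) / eps ^ 2 + 2 * (u * p + v * q) * G / eps ^ 2).
    + rewrite Hr, Ho. field. lra.
    + field. lra.
Qed.

(** The coordinates in the basis (es, em) are affine along the line. *)
Lemma sector_line omega es er em erm (x d : R * R) :
  sector_frame omega es er em erm -> sector es em x ->
  locally 0 (fun t : R => sector es em (plus x (scal t d))).
Proof.
  intros H Hx.
  destruct (frame_transversal _ _ _ _ _ H) as [k1 k2].
  assert (O1 := orthonormal_of_frame _ _ (frame_es _ _ _ _ _ H) (frame_er _ _ _ _ _ H)
     (frame_er_orth _ _ _ _ _ H)).
  (* coordinates of y in the basis (es, em) *)
  set (c := fun y => dot y er / dot em er). set (a := fun y => dot y es - c y * dot em es).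
  assert (De : forall y : R * R, y = plus (scal (a y) es) (scal (c y) em)).
  { intros y.
    assert (Dy := orthonormal_decomposition es er y O1).
    assert (Dm := orthonormal_decomposition es er em O1).
    assert (E : dot y er = c y * dot em er) by (unfold c; field; lra).
    transitivity (plus (scal (dot y es) es) (scal (dot y er) er)); [now symmetry|].
    rewrite E. unfold a.
    transitivity (plus (scal (dot y es - c y * dot em es) es)
       (scal (c y) (plus (scal (dot em es) es) (scal (dot em er) er)))); [|now rewrite Dm].
    generalize (c y), (dot y es), (dot em es), (dot em er). intros.
    destruct es, er. unfold_coords. pair_ring. }
  assert (pos : 0 < a x /\ 0 < c x).
  { destruct Hx as (a' & c' & Ha & Hc & ->). unfold a, c.
    rewrite !dot_plus_scal, (dot_sym es er), (frame_er_orth _ _ _ _ _ H).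
    destruct O1 as (N1 & _). replace (dot es es) with (fst es ^ 2 + snd es ^ 2) by (unfold dot; ring).
    rewrite N1. split.
    - replace (_ - _) with a'; [exact Ha|field; lra].
    - replace (_ / _) with c'; [exact Hc|field; lra]. }
  assert (lin : forall t, a (plus x (scal t d)) = a x + t * a d /\ c (plus x (scal t d)) = c x + t * c d).
  { intros t. unfold a, c. clear - k1. destruct x, d, es, er, em. unfold dot in *. unfold_coords.
    cbn [fst snd] in k1. split; field; lra. }
  generalize (filter_and _ _ (locally_0_affine_pos (a x) (a d) (proj1 pos))
     (locally_0_affine_pos (c x) (c d) (proj2 pos))).
  apply filter_imp. intros t [h1 h2]. destruct (lin t) as [l1 l2].
  exists (a (plus x (scal t d))), (c (plus x (scal t d))).
  split; [exact (eq_rect_r (Rlt 0) h1 l1)|split; [exact (eq_rect_r (Rlt 0) h2 l2)|apply De]].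
Qed.

Lemma plus_scal_scal (x e : R * R) (a t : R) :
  plus x (scal t (scal a e)) = plus x (scal (a * t) e).
Proof. destruct x, e. unfold_coords. pair_ring. Qed.

Lemma has_laplacian_corner omega es er em erm (z : R * R -> R) (eps : R) (x : R * R) :
  sector_frame omega es er em erm -> 0 < eps -> Ck_on 2 (sector es em) z ->
  sector es em x ->
  has_laplacian (fun y => z (scal (/ eps) y)) x (laplacian z (scal (/ eps) x) / eps ^ 2).
Proof.
  intros H Heps Cz Hx. set (eta := scal (/ eps) x : R * R).
  assert (Heta : sector es em eta) by (apply sector_scal; [now apply Rinv_0_lt_compat|exact Hx]).
  assert (L : forall e : R * R, second_derivative_at_0
      (fun t => z (scal (/ eps) (plus x (scal t e)))) (/ eps ^ 2 * ddir e (ddir e z) eta)).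
  { intros e.
    assert (G : forall l, (length l < 2)%nat -> locally 0 (fun t => is_derive
       (fun h => ddirs l z (plus eta (scal (/ eps * h) e))) t
       (/ eps * ddir e (ddirs l z) (plus eta (scal (/ eps * t) e))))).
    { intros l Hl.
      generalize (sector_line _ _ _ _ _ eta (scal (/ eps) e) H Heta). apply filter_imp.
      intros t Ht.
      apply (is_derive_comp (fun h => ddirs l z (plus eta (scal h e))) (fun h => / eps * h)).
      - apply (is_derive_line (V := plane)).
        rewrite plus_scal_scal in Ht. exact (proj2 (Cz l _ Ht) Hl e).
      - auto_derive; auto; ring. }
    eapply second_derivative_ext with (f := fun h => z (plus eta (scal (/ eps * h) e))).
    - intros t. apply (f_equal z). unfold eta. destruct x, e. unfold_coords. pair_ring.
    - exists (fun t => / eps * ddir e z (plus eta (scal (/ eps * t) e))). split.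
      + apply (G []). simpl. lia.
      + assert (G1 := locally_singleton _ _ (G [e] ltac:(simpl; lia))). cbv beta in G1. simpl in G1.
        rewrite Rmult_0_r, plus_scal_0 in G1.
        eapply is_derive_eq; [apply is_derive_scal; exact G1|]. unfold eta. field. lra. }
  exists (/ eps ^ 2 * d_1 (d_1 z) eta), (/ eps ^ 2 * d_2 (d_2 z) eta).
  split; [apply L|split; [apply L|]]. rewrite laplacian_ddir. field. lra.
Qed.

Lemma has_laplacian_smooth u (x : R * R) : smooth_on everywhere u -> has_laplacian u x (laplacian u x).
Proof.
  intros S. exists (d_1 (d_1 u) x), (d_2 (d_2 u) x). rewrite laplacian_ddir.
  assert (L : forall e : R * R,
    second_derivative_at_0 (fun t => u (plus x (scal t e))) (ddir e (ddir e u) x)).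
  { intros e. exists (fun t => ddir e u (plus x (scal t e))). split.
    - apply filter_forall. intros t.
      exact (is_derive_line (V := plane) e u x t (smooth_ex_ddir everywhere u [] e _ S I)).
    - exact (is_ddir (V := plane) e _ x (smooth_ex_ddir everywhere u [e] e _ S I)). }
  split; [apply L|split; [apply L|reflexivity]].
Qed.

(** * The asymptotic solution *)

Lemma has_laplacian_ext (f g : R * R -> R) (x : R * R) L :
  (forall y, f y = g y) -> has_laplacian f x L -> has_laplacian g x L.
Proof.
  intros E (l1 & l2 & H1 & H2 & H). exists l1, l2.
  split; [|split; [|exact H]]; (eapply second_derivative_ext; [|eassumption]); intros t; apply E.
Qed.

Lemma u_as_scaled es er em erm u0 v0 v1 v0m v1m z0 z1 (eps : R) (eta : R * R) : 0 < eps ->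
  u_as es er em erm u0 v0 v1 v0m v1m z0 z1 eps (scal eps eta) =
  u0 (scal eps eta) + layer_path v0 v1 (dot eta er) (dot eta es) eps
  + layer_path v0m v1m (dot eta erm) (dot eta em) eps
  + (q0 er erm v0 v0m z0 eta + eps * q1 es er em erm v0 v1 v0m v1m z1 eta).
Proof.
  intros He. unfold u_as, v_as, layer_path.
  replace (scal (/ eps) (scal eps eta)) with eta.
  2:{ destruct eta. unfold_coords. apply (f_equal2 pair);
      field_R. }
  rewrite !dot_scal.
  replace (eps * dot eta er / eps) with (dot eta er) by (field; lra).
  replace (eps * dot eta erm / eps) with (dot eta erm) by (field; lra).
  reflexivity.
Qed.

Lemma has_laplacian_u_as omega es er em erm u0 v0 v1 v0m v1m z0 z1 (eps : R) (x : R * R) :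
  sector_frame omega es er em erm -> smooth_on everywhere u0 ->
  smooth_on half_plane v0 -> smooth_on half_plane v1 ->
  smooth_on half_plane v0m -> smooth_on half_plane v1m ->
  Ck_on 2 (sector es em) z0 -> Ck_on 2 (sector es em) z1 ->
  0 < eps -> sector es em x ->
  let eta := scal (/ eps) x : R * R in
  let P := (dot x er / eps, dot x es) in
  let Pm := (dot x erm / eps, dot x em) in
  let xi := dot eta er in
  let xim := dot eta erm in
  has_laplacian (u_as es er em erm u0 v0 v1 v0m v1m z0 z1 eps) x
    (laplacian u0 x
     + ((d_1 (d_1 v0) P / eps ^ 2 + d_2 (d_2 v0) P)
        + eps * (d_1 (d_1 v1) P / eps ^ 2 + d_2 (d_2 v1) P))
     + ((d_1 (d_1 v0m) Pm / eps ^ 2 + d_2 (d_2 v0m) Pm)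
        + eps * (d_1 (d_1 v1m) Pm / eps ^ 2 + d_2 (d_2 v1m) Pm))
     + ((laplacian z0 eta / eps ^ 2 - d_1 (d_1 v0) (xi, 0) / eps ^ 2
         - d_1 (d_1 v0m) (xim, 0) / eps ^ 2)
        + eps * (laplacian z1 eta / eps ^ 2
          - (d_1 (d_1 v1) (xi, 0) / eps ^ 2
             + dot eta es * d_1 (d_1 (d_2 v0)) (xi, 0) / eps ^ 2)
          - (d_1 (d_1 v1m) (xim, 0) / eps ^ 2
             + dot eta em * d_1 (d_1 (d_2 v0m)) (xim, 0) / eps ^ 2)))).
Proof.
  intros hf Su S0 S1 S0m S1m C0 C1 Heps Hx. cbv zeta.
  assert (O1 := orthonormal_of_frame _ _ (frame_es _ _ _ _ _ hf) (frame_er _ _ _ _ _ hf)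
     (frame_er_orth _ _ _ _ _ hf)).
  assert (O2 := orthonormal_of_frame _ _ (frame_em _ _ _ _ _ hf) (frame_erm _ _ _ _ _ hf)
     (frame_erm_orth _ _ _ _ _ hf)).
  assert (Hr := frame_er_inward _ _ _ _ _ hf x Hx).
  assert (Hrm := frame_erm_inward _ _ _ _ _ hf x Hx).
  apply (has_laplacian_ext (fun y =>
     u0 y + (v0 (dot y er / eps, dot y es) + eps * v1 (dot y er / eps, dot y es))
     + (v0m (dot y erm / eps, dot y em) + eps * v1m (dot y erm / eps, dot y em))
     + ((z0 (scal (/ eps) y) - v0 (dot (scal (/ eps) y) er, 0) - v0m (dot (scal (/ eps) y) erm, 0))
        + eps * (z1 (scal (/ eps) y)
           - (v1 (dot (scal (/ eps) y) er, 0)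
              + dot (scal (/ eps) y) es * d_2 v0 (dot (scal (/ eps) y) er, 0))
           - (v1m (dot (scal (/ eps) y) erm, 0)
              + dot (scal (/ eps) y) em * d_2 v0m (dot (scal (/ eps) y) erm, 0)))))).
  { intros y. unfold u_as, v_as, q0, q1, layer1. now rewrite !Derive_snd. }
  assert (LA := fun f => has_laplacian_layer f es er eps x O1 Heps).
  assert (LAm := fun f => has_laplacian_layer f em erm eps x O2 Heps).
  assert (LB := fun f => has_laplacian_layer_corner f es er eps x O1 Heps).
  assert (LBm := fun f => has_laplacian_layer_corner f em erm eps x O2 Heps).
  assert (LC := fun f => has_laplacian_layer_corner_tangential f es er eps x O1 Heps).
  assert (LCm := fun f => has_laplacian_layer_corner_tangential f em erm eps x O2 Heps).
  assert (LD := fun z => has_laplacian_corner omega es er em erm z eps x hf Heps).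
  assert (S0' := smooth_ddir _ _ e_2 S0). assert (S0m' := smooth_ddir _ _ e_2 S0m).
  assert (Lu := has_laplacian_smooth u0 x Su).
  assert (LV := has_laplacian_plus _ _ _ _ _ (LA v0 S0 Hr)
    (has_laplacian_scal _ _ _ eps (LA v1 S1 Hr))).
  assert (LVm := has_laplacian_plus _ _ _ _ _ (LAm v0m S0m Hrm)
    (has_laplacian_scal _ _ _ eps (LAm v1m S1m Hrm))).
  assert (LQ0 := has_laplacian_minus _ _ _ _ _
    (has_laplacian_minus _ _ _ _ _ (LD z0 C0 Hx) (LB v0 S0 Hr)) (LBm v0m S0m Hrm)).
  assert (LQ1 := has_laplacian_minus _ _ _ _ _
    (has_laplacian_minus _ _ _ _ _ (LD z1 C1 Hx)
       (has_laplacian_plus _ _ _ _ _ (LB v1 S1 Hr) (LC (d_2 v0) S0' Hr)))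
    (has_laplacian_plus _ _ _ _ _ (LBm v1m S1m Hrm) (LCm (d_2 v0m) S0m' Hrm))).
  exact (has_laplacian_plus _ _ _ _ _
    (has_laplacian_plus _ _ _ _ _ (has_laplacian_plus _ _ _ _ _ Lu LV) LVm)
    (has_laplacian_plus _ _ _ _ _ LQ0 (has_laplacian_scal _ _ _ eps LQ1))).
Qed.

Lemma laplacian_bounded gamma b u0 : reaction_data gamma b u0 ->
  exists K, forall x : R * R, Rabs (laplacian u0 x) <= K.
Proof.
  intros hb.
  assert (T := tame_of_space u0 (u0_smooth _ _ _ hb) (u0_bounded _ _ _ hb) 2).
  destruct (tame_bounded 0 _ 0 (tame_ddir _ _ e_x1 (tame_ddir _ _ e_x1 T))) as [K1 H1].
  destruct (tame_bounded 0 _ 0 (tame_ddir _ _ e_x2 (tame_ddir _ _ e_x2 T))) as [K2 H2].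
  exists (K1 + K2). intros x. rewrite laplacian_ddir.
  assert (z : Rabs 0 <= 0) by (rewrite Rabs_R0; lra).
  eapply Rle_trans; [apply Rabs_triang|].
  exact (Rplus_le_compat _ _ _ _ (H1 x 0 z) (H2 x 0 z)).
Qed.

(** After the boundary layer remainders (R3, R4) and the corner remainder (R5) have
been split off, only eps^2 times the Laplacian of u0 and the tangential second
derivatives of the layers remain. *)
Lemma interior_residual {omega gamma b u0 g es er em erm gl glm v0 v1 v0m v1m z0 z1}
    (hf : sector_frame omega es er em erm)
    (hb : reaction_data gamma b u0)
    (hv : boundary_layer gamma b u0 es er gl v0 v1)
    (hvm : boundary_layer gamma b u0 em erm glm v0m v1m)
    (hz : corner_layer b u0 g es er em erm gl glm v0 v1 v0m v1m z0 z1) :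
  exists C, forall eps : R, 0 < eps < 1 -> forall x : R * R, sector es em x ->
    Rabs (F b eps (u_as es er em erm u0 v0 v1 v0m v1m z0 z1 eps) x) <= C * eps ^ 2.
Proof.
  assert (O1 := orthonormal_of_frame _ _ (frame_es _ _ _ _ _ hf) (frame_er _ _ _ _ _ hf)
     (frame_er_orth _ _ _ _ _ hf)).
  assert (O2 := orthonormal_of_frame _ _ (frame_em _ _ _ _ _ hf) (frame_erm _ _ _ _ _ hf)
     (frame_erm_orth _ _ _ _ _ hf)).
  assert (g0 := gamma_pos _ _ _ hb).
  destruct (laplacian_bounded _ _ _ hb) as [K0 H0].
  destruct (layer_decay hb hv) as (K1 & K1p & H1).
  destruct (layer_decay hb hvm) as (K2 & K2p & H2).
  destruct (layer_normal_residual hb hv O1) as (K3 & K3p & H3).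
  destruct (layer_normal_residual hb hvm O2) as (K4 & K4p & H4).
  destruct (corner_residual hf hb hv hvm hz) as (K5 & K5p & H5).
  exists (K0 + 2 * K1 + 2 * K2 + K3 + K4 + K5). intros eps Heps x Hx.
  set (eta := scal (/ eps) x : R * R).
  assert (Heta : sector es em eta) by (apply sector_scal; [apply Rinv_0_lt_compat; lra|exact Hx]).
  assert (Ex : x = scal eps eta).
  { unfold eta. destruct x. unfold_coords. apply (f_equal2 pair);
    field_R. }
  unfold F.
  rewrite (has_laplacian_unique _ _ _ (has_laplacian_u_as omega es er em erm u0 v0 v1 v0m v1m z0 z1
     eps x hf (u0_smooth _ _ _ hb) (v0_smooth _ _ _ _ _ _ _ _ hv) (v1_smooth _ _ _ _ _ _ _ _ hv)
     (v0_smooth _ _ _ _ _ _ _ _ hvm) (v1_smooth _ _ _ _ _ _ _ _ hvm)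
     (z0_C2 _ _ _ _ _ _ _ _ _ _ _ _ _ _ _ hz) (z1_C2 _ _ _ _ _ _ _ _ _ _ _ _ _ _ _ hz)
     (proj1 Heps) Hx)).
  fold eta.
  assert (Xi : dot x er / eps = dot eta er) by (rewrite Ex at 1; rewrite dot_scal; field; lra).
  assert (Xim : dot x erm / eps = dot eta erm) by (rewrite Ex at 1; rewrite dot_scal; field; lra).
  assert (Sg : dot x es = eps * dot eta es) by (rewrite Ex at 1; apply dot_scal).
  assert (Sgm : dot x em = eps * dot eta em) by (rewrite Ex at 1; apply dot_scal).
  rewrite Xi, Xim, Sg, Sgm.
  assert (Hxi := frame_er_inward _ _ _ _ _ hf eta Heta : 0 < dot eta er).
  assert (Hxim := frame_erm_inward _ _ _ _ _ hf eta Heta : 0 < dot eta erm).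
  specialize (H0 x).
  specialize (H5 eps eta ltac:(lra) Heta). cbv zeta in H5.
  specialize (H3 eps (dot eta er) (eps * dot eta es) ltac:(lra) Hxi).
  specialize (H4 eps (dot eta erm) (eps * dot eta em) ltac:(lra) Hxim).
  destruct (H1 (dot eta er) (eps * dot eta es) Hxi) as (_ & _ & _ & _ & D0 & D1).
  destruct (H2 (dot eta erm) (eps * dot eta em) Hxim) as (_ & _ & _ & _ & D0m & D1m).
  set (p := layer_path v0 v1 (dot eta er) (dot eta es) eps) in *.
  set (pm := layer_path v0m v1m (dot eta erm) (dot eta em) eps) in *.
  set (q := q0 er erm v0 v0m z0 eta + eps * q1 es er em erm v0 v1 v0m v1m z1 eta) in *.
  assert (B1 : b x (u_as es er em erm u0 v0 v1 v0m v1m z0 z1 eps x)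
     = reaction b u0 (x, p + pm + q)).
  { unfold reaction, B. cbn [fst snd]. f_equal. rewrite Ex. rewrite u_as_scaled by lra.
    fold p pm q. ring. }
  assert (B2 : plus origin (scal eps eta) = x)
    by (rewrite Ex; destruct (scal eps eta); unfold origin; unfold_coords; pair_ring).
  assert (B3 : forall e r, orthonormal e r ->
    plus (scal (eps * dot eta e) e) (scal eps (scal (dot eta r) r)) = x).
  { intros e r Her. rewrite Ex. rewrite <- (orthonormal_decomposition e r eta Her) at 3.
    generalize (dot eta e) (dot eta r). intros s t. destruct e, r. unfold_coords. pair_ring. }
  rewrite B1. rewrite B3 in H3, H4 by assumption. rewrite B2 in H5.
  match type of H3 with Rabs (_ - ?t - ?t') <= ?K =>
    change (Rabs (reaction b u0 (x, p) - t - t') <= K) in H3 end.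
  match type of H4 with Rabs (_ - ?t - ?t') <= ?K =>
    change (Rabs (reaction b u0 (x, pm) - t - t') <= K) in H4 end.
  match type of H5 with Rabs (_ - _ - _ - ?t - ?t') <= ?K =>
    change (Rabs (reaction b u0 (x, p + pm + q) - reaction b u0 (x, p) - reaction b u0 (x, pm)
      - t - t') <= K) in H5 end.
  set (E1 := exp (- (gamma / 2) * dot eta er)) in *.
  set (E2 := exp (- (gamma / 2) * dot eta erm)) in *.
  assert (e1 : E1 <= 1).
  { unfold E1. rewrite <- exp_0. left; apply exp_increasing. nra. }
  assert (e2 : E2 <= 1).
  { unfold E2. rewrite <- exp_0. left; apply exp_increasing. nra. }
  assert (k1 : K1 * E1 <= K1) by nra. assert (k2 : K2 * E2 <= K2) by nra.
  set (ss := d_2 (d_2 v0) (dot eta er, eps * dot eta es)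
     + eps * d_2 (d_2 v1) (dot eta er, eps * dot eta es)).
  set (ssm := d_2 (d_2 v0m) (dot eta erm, eps * dot eta em)
     + eps * d_2 (d_2 v1m) (dot eta erm, eps * dot eta em)).
  assert (hs : Rabs ss <= 2 * K1).
  { unfold ss. eapply Rle_trans; [apply Rabs_triang|]. rewrite Rabs_mult, (Rabs_pos_eq eps) by lra.
    assert (h := Rabs_pos (d_2 (d_2 v1) (dot eta er, eps * dot eta es))). nra. }
  assert (hsm : Rabs ssm <= 2 * K2).
  { unfold ssm. eapply Rle_trans; [apply Rabs_triang|]. rewrite Rabs_mult, (Rabs_pos_eq eps) by lra.
    assert (h := Rabs_pos (d_2 (d_2 v1m) (dot eta erm, eps * dot eta em))). nra. }
  match type of H3 with Rabs ?t <= _ => set (R3 := t) in H3 end.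
  match type of H4 with Rabs ?t <= _ => set (R4 := t) in H4 end.
  match type of H5 with Rabs ?t <= _ => set (R5 := t) in H5 end.
  match goal with |- Rabs ?t <= _ => replace t
    with (- eps ^ 2 * (laplacian u0 x + ss + ssm) + R3 + R4 + R5) end.
  2:{ unfold R3, R4, R5, ss, ssm. field. lra. }
  assert (e0 : 0 <= eps ^ 2) by apply pow2_ge_0.
  eapply Rle_trans; [apply Rabs_triang|].
  eapply Rle_trans; [apply Rplus_le_compat_r, Rabs_triang|].
  eapply Rle_trans; [apply Rplus_le_compat_r, Rplus_le_compat_r, Rabs_triang|].
  assert (Hm : Rabs (- eps ^ 2 * (laplacian u0 x + ss + ssm)) <= eps ^ 2 * (K0 + 2 * K1 + 2 * K2)).
  { rewrite Rabs_mult, Rabs_Ropp, (Rabs_pos_eq (eps ^ 2)) by exact e0.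
    apply Rmult_le_compat_l; [exact e0|].
    eapply Rle_trans; [apply Rabs_triang|].
    eapply Rle_trans; [apply Rplus_le_compat_r, Rabs_triang|]. lra. }
  lra.
Qed.

(** The conditions on the side leave the Taylor remainder of the layer of the other
side.  The corner rho = 0, where that layer is not known to be smooth, is a
separate case, in which everything cancels. *)
Lemma boundary_error {gamma b u0 e r em rm gl glm v0 v1 v0m v1m}
    (g z0 z1 : R * R -> R)
    (hb : reaction_data gamma b u0)
    (hside : side_data b u0 g e gl)
    (hv : boundary_layer gamma b u0 e r gl v0 v1)
    (hvm : boundary_layer gamma b u0 em rm glm v0m v1m) :
  orthonormal e r -> orthonormal em rm -> 0 < dot e rm ->
  (forall eta, ray e eta -> z0 eta = g origin - u0 origin) ->
  (forall sigma, 0 <= sigma ->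
    z1 (scal sigma e) = sigma * Derive (fun s => gl s - u0 (scal s e)) 0) ->
  exists C, forall eps : R, 0 < eps < 1 -> forall x : R * R, ray e x ->
    Rabs (u_as e r em rm u0 v0 v1 v0m v1m z0 z1 eps x - g x) <= C * eps ^ 2.
Proof.
  intros O1 O2 Ht hz0 hz1.
  destruct (layer_path_taylor_along_ray hb hvm e O2 Ht) as [K HK].
  exists (Rmax 0 K). intros eps Heps x (s & Hs & ->).
  assert (e2 : 0 <= eps ^ 2) by apply pow2_ge_0.
  assert (bc := v0_bc _ _ _ _ _ _ _ _ hv).
  assert (bc1 := v1_bc _ _ _ _ _ _ _ _ hv).
  assert (gr := gl_restr _ _ _ _ _ hside s Hs).
  assert (g0 := gl_restr _ _ _ _ _ hside 0 (Rle_refl 0)). rewrite scal_0_origin in g0.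
  set (rho := s / eps).
  assert (Es : s = eps * rho) by (unfold rho; field; lra).
  assert (Hrho : 0 <= rho) by (apply Rdiv_le_0_compat; lra).
  assert (Ex : scal s e = scal eps (scal rho e) :> R * R).
  { rewrite Es. destruct e. unfold_coords. pair_ring. }
  assert (De : dot e r = 0) by (rewrite dot_sym; apply O1).
  assert (Dee : dot e e = 1) by (rewrite <- (proj1 O1); unfold dot; ring).
  assert (bcO : v0 (0, 0) = g origin - u0 origin) by (rewrite bc, scal_0_origin, g0; reflexivity).
  assert (bcD : d_2 v0 (0, 0) = Derive (fun s => gl s - u0 (scal s e)) 0).
  { rewrite <- Derive_snd. apply Derive_ext. intros t. apply bc. }
  rewrite gr, Ex, u_as_scaled by lra. rewrite <- Ex.
  rewrite !dot_scal, De, Dee, Rmult_0_r, Rmult_1_r.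
  unfold q0, q1, layer1. rewrite !Derive_snd, !dot_scal, De, Dee, !Rmult_0_r, Rmult_1_r.
  rewrite hz0 by (now exists rho). rewrite hz1 by exact Hrho. rewrite bcO, bcD, bc1.
  unfold layer_path at 1. rewrite bc, bc1.
  set (D := Derive (fun s => gl s - u0 (scal s e)) 0).
  replace (eps * rho) with s by (now symmetry).
  match goal with |- Rabs ?t <= _ => replace t with
    (layer_path v0m v1m (rho * dot e rm) (rho * dot e em) eps - v0m (rho * dot e rm, 0)
      - eps * (v1m (rho * dot e rm, 0) + rho * dot e em * d_2 v0m (rho * dot e rm, 0))) by ring end.
  destruct Hrho as [Hrho|Hrho].
  - eapply Rle_trans; [apply HK; lra|]. apply Rmult_le_compat_r; [exact e2|apply Rmax_r].
  - rewrite <- Hrho. unfold layer_path. rewrite !Rmult_0_l, !Rmult_0_r.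
    rewrite (v1_bc _ _ _ _ _ _ _ _ hvm).
    replace (_ - _ - _) with 0 by ring. rewrite Rabs_R0.
    apply Rmult_le_pos; [apply Rmax_l|exact e2].
Qed.

Lemma u_as_swap es er em erm u0 v0 v1 v0m v1m z0 z1 eps x :
  u_as es er em erm u0 v0 v1 v0m v1m z0 z1 eps x
  = u_as em erm es er u0 v0m v1m v0 v1 z0 z1 eps x.
Proof. unfold u_as, q0, q1. ring. Qed.

Theorem lemma3p1 (omega gamma : R) (es er em erm : R * R)
    (b : R * R -> R -> R) (u0 g : R * R -> R) (gl glm : R -> R)
    (v0 v1 v0m v1m z0 z1 : R * R -> R)
    (hframe : sector_frame omega es er em erm)
    (hdata : reaction_data gamma b u0)
    (hside : side_data b u0 g es gl)
    (hsidem : side_data b u0 g em glm)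
    (hA3 : 0 < b origin (g origin))
    (hv : boundary_layer gamma b u0 es er gl v0 v1)
    (hvm : boundary_layer gamma b u0 em erm glm v0m v1m)
    (hz : corner_layer b u0 g es er em erm gl glm v0 v1 v0m v1m z0 z1) :
  (exists C eps0 : R, 0 < eps0 /\ forall eps : R, 0 < eps < eps0 ->
     forall x : R * R, sector es em x ->
       Rabs (F b eps (u_as es er em erm u0 v0 v1 v0m v1m z0 z1 eps) x) <= C * eps ^ 2) /\
  (exists C eps0 : R, 0 < eps0 /\ forall eps : R, 0 < eps < eps0 ->
     forall x : R * R, sector_boundary es em x ->
       Rabs (u_as es er em erm u0 v0 v1 v0m v1m z0 z1 eps x - g x) <= C * eps ^ 2).
Proof.
  split.
  - destruct (interior_residual hframe hdata hv hvm hz) as [C HC].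
    exists C, 1. split; [lra|exact HC].
  - assert (O1 := orthonormal_of_frame _ _ (frame_es _ _ _ _ _ hframe) (frame_er _ _ _ _ _ hframe)
       (frame_er_orth _ _ _ _ _ hframe)).
    assert (O2 := orthonormal_of_frame _ _ (frame_em _ _ _ _ _ hframe) (frame_erm _ _ _ _ _ hframe)
       (frame_erm_orth _ _ _ _ _ hframe)).
    destruct (frame_transversal _ _ _ _ _ hframe) as [k1 k2].
    assert (bz := z0_bc _ _ _ _ _ _ _ _ _ _ _ _ _ _ _ hz).
    destruct (boundary_error g z0 z1 hdata hside hv hvm O1 O2 k2
      (fun eta H => bz eta (or_introl H)) (z1_bc _ _ _ _ _ _ _ _ _ _ _ _ _ _ _ hz)) as [C HC].
    destruct (boundary_error g z0 z1 hdata hsidem hvm hv O2 O1 k1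
      (fun eta H => bz eta (or_intror H)) (z1_bcm _ _ _ _ _ _ _ _ _ _ _ _ _ _ _ hz)) as [Cm HCm].
    exists (Rmax C Cm), 1. split; [lra|]. intros eps Heps x Hx.
    assert (e2 : 0 <= eps ^ 2) by apply pow2_ge_0.
    destruct Hx as [Hx|Hx].
    + eapply Rle_trans; [now apply HC|]. apply Rmult_le_compat_r; [exact e2|apply Rmax_l].
    + rewrite u_as_swap. eapply Rle_trans; [now apply HCm|].
      apply Rmult_le_compat_r; [exact e2|apply Rmax_r].
Qed.
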